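(* Let $h : A \to B$ be a morphism of MV-algebras. Then there is a morphism of $l_u$-groups $h^* : A^* \to B^*$ such that the following diagram commutes: $h^*$ is the restriction to $A^*$ of the map $\prod_{P \in Sp(A)} \mathrm{Ch}(A/P) \to \prod_{P \in Sp(B)} \mathrm{Ch}(B/P)$ induced by $h$ (defined in the context); $h^*$ maps $A^\circ = \Gamma(A^*,u)$ into $B^\circ = \Gamma(B^*,u)$, the restriction being $\Gamma(h^* )$; and $\Gamma(h^* )\circ(\imath\,\widehat{(-)}^v)_A = (\imath\,\widehat{(-)}^v)_B\circ h$, i.e. $h^*(\imath\,\widehat{a}^v) = \imath\,\widehat{h(a)}^v$ for all $a\in A$. This defines a functor $(-)^* : \mathcal{M} \to \mathcal{G}_u$ in such a way that the isomorphisms $\imath\,\widehat{(-)}^v : A \to \Gamma(A^*,u)$ (for $A$ in $\mathcal{M}$) and $\upsilon : \Gamma(G,u)^* \to (G,u)$ (for $(G,u)$ in $\mathcal{G}_u$) become natural transformations (from the identity of $\mathcal{M}$ to $\Gamma\circ(-)^*$, and from $(-)^*\circ\Gamma$ to the identity of $\mathcal{G}_u$, respectively).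
   Context: $\mathcal{M}$ is the category of MV-algebras and MV-algebra morphisms. $\mathcal{G}_u$ is the category of $l_u$-groups: an $l_u$-group $(G,u)$ is a lattice-ordered abelian group $G$ with a distinguished strong unit $u$ ($u\ge 0$, and for every $x \in G$ there is an integer $n \geq 0$ with $|x| \leq nu$, where $|x| = (0\vee x) + (0 \vee -x)$); morphisms $(G,u)\to(H,v)$ are group homomorphisms preserving $\vee,\wedge$ and sending $u$ to $v$. An $l_u$-chain is a totally ordered $l_u$-group. The segment functor $\Gamma:\mathcal{G}_u\to\mathcal{M}$ is $\Gamma(G,u) = [0,u] = \{x \in G \mid 0 \leq x \leq u\}$, an MV-algebra with $x \oplus y = u \wedge (x+y)$, $\neg x = u - x$; on arrows it is restriction. In an MV-algebra, $1=\neg 0$, $a\odot b=\neg(\neg a\oplus\neg b)$, $a\le b\iff\neg a\oplus b=1$. An ideal of an MV-algebra is a subset containing $0$, downward closed and closed under $\oplus$; a proper ideal $P$ of $A$ is prime if $A/P$ is totally ordered. $Sp(A)$ is the set of prime ideals of $A$; $[a]_P$ is the class of $a$ in $A/P$. Chang's construction: for a totally ordered MV-algebra $C$, $\mathrm{Ch}(C) = \{(m,a) \mid m \in \mathbb{Z},\ a \in C\}$, where $(m+1,0)$ and $(m,1)$ are identified for every $m\in\mathbb{Z}$, ordered lexicographically, with $(m,a)+(n,b) = (m+n, a\oplus b)$ if $a \oplus b < 1$; $(m,a)+(n,b) = (m+n+1, a \odot b)$ if $a \oplus b = 1$; $-(m,a) = (-m-1, \neg a)$. $\mathrm{Ch}(C)$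 is an $l_u$-chain with strong unit $(0,1)$ (Chang). For a morphism $f : C \to D$ of totally ordered MV-algebras, $\mathrm{Ch}(f) : \mathrm{Ch}(C)\to\mathrm{Ch}(D)$ is $(m,a)\mapsto(m,f(a))$. For an MV-algebra $A$ and $a \in A$, let $\imath\,\widehat{a}^v \in \prod_{P \in Sp(A)} \mathrm{Ch}(A/P)$ be given by $(\imath\,\widehat{a}^v)(P) = (0,[a]_P)$. Let $A^\circ = \{\imath\,\widehat{a}^v \mid a \in A\}$, let $A^*$ be the subgroup of $\prod_{P \in Sp(A)} \mathrm{Ch}(A/P)$ (pointwise $l$-group structure) generated by $A^\circ$, and $u = \imath\,\widehat{1}^v$. Then $A^*$ is an $l_u$-group with strong unit $u$, $A^\circ=\Gamma(A^*,u)$, and $\imath\,\widehat{(-)}^v : A \to \Gamma(A^*,u)$, $a\mapsto\imath\,\widehat{a}^v$, is an isomorphism. Map on products induced by $h : A\to B$: for $P \in Sp(B)$, $h^{-1}P \in Sp(A)$ and $h|_P : A/h^{-1}P \to B/P$, $[a]_{h^{-1}P}\mapsto[h(a)]_P$, is a well-defined MV-morphism. The induced map $\prod_{P \in Sp(A)} \mathrm{Ch}(A/P) \to \prod_{P \in Sp(B)} \mathrm{Ch}(B/P)$ sends $\sigma$ to the section $P \mapsto \mathrm{Ch}(h|_P)(\sigma(h^{-1}P))$. The isomorphism $\upsilon$: for an $l_u$-group $(G,u)$ let $Sp(G)$ be the set of prime $l$-ideals of $G$ (proper convex sublattice subgroups $P$ with $G/P$ totally ordered). The map $P\mapsto P\cap[0,u]$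 is a bijection $Sp(G)\to Sp(\Gamma(G,u))$, and $\Gamma(G,u)/(P\cap[0,u])\cong\Gamma(G/P,[u]_P)$ via $[x]_{P\cap[0,u]}\mapsto[x]_P$. With these identifications, $\Gamma(G,u)^*\subset\prod_{P\in Sp(G)}\mathrm{Ch}(\Gamma(G/P,[u]_P))$. Applying on each fiber Chang's isomorphism $\mathrm{Ch}(\Gamma(G/P,[u]_P))\to G/P$, $(m,a)\mapsto m[u]_P+a$, gives a map $\Gamma(G,u)^*\to\prod_{P\in Sp(G)}G/P$ which factors through the canonical embedding $G\to\prod_{P\in Sp(G)}G/P$, $x\mapsto([x]_P)_P$; the resulting map $\upsilon:\Gamma(G,u)^*\to(G,u)$ is an isomorphism of $l_u$-groups, and satisfies $\upsilon(\imath\,\widehat{x}^v)=x$ for $x\in\Gamma(G,u)$. *)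

(* Defs.v *)
From HB Require Import structures.
From Stdlib Require Import Relation_Operators.
From mathcomp Require Import all_boot all_order all_algebra.
From mathcomp Require Import zify.
From mathcomp Require Import boolp classical_sets.

Set Implicit Arguments.
Unset Strict Implicit.
Unset Printing Implicit Defensive.

Import Order.TTheory GRing.Theory Num.Theory.

Declare Scope mv_scope.
Delimit Scope mv_scope with MV.
Local Open Scope classical_set_scope.
Local Open Scope quotient_scope.
Local Open Scope ring_scope.
Local Open Scope mv_scope.

(** Carriers are [choiceType]s; by [gen_eqMixin] and [gen_choiceMixin] this is
    no restriction on the underlying type. *)
HB.mixin Record isMV A of Choice A := {
  mv0 : A;
  mvneg : A -> A;
  mvadd : A -> A -> A;
  mvaddA : associative mvadd;
  mvaddC : commutative mvadd;
  mvadd0 : right_id mv0 mvadd;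
  mvnegK : involutive mvneg;
  mvaddn0 : forall x, mvadd x (mvneg mv0) = mvneg mv0;
  mvadd_luk : forall x y,
    mvadd (mvneg (mvadd (mvneg x) y)) y = mvadd (mvneg (mvadd (mvneg y) x)) x
}.

#[short(type="mvType")]
HB.structure Definition MV := {A of isMV A & Choice A}.

Notation "x ⊕ y" := (mvadd x y) (at level 50, left associativity) : mv_scope.
Notation "¬ x" := (mvneg x) (at level 35, right associativity) : mv_scope.

Definition mv1 {A : mvType} : A := ¬ mv0.
Definition mvmul {A : mvType} (x y : A) : A := ¬ (¬ x ⊕ ¬ y).
Definition mvle {A : mvType} (x y : A) : bool := ¬ x ⊕ y == mv1.

Notation "x ⊙ y" := (mvmul x y) (at level 40, left associativity) : mv_scope.
Notation "x ≤ y" := (mvle x y) (at level 70, no associativity) : mv_scope.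

HB.mixin Record isMVTotal A of MV A := {
  mvle_total : total (@mvle A)
}.

#[short(type="mvChainType")]
HB.structure Definition MVChain := {A of isMVTotal A & MV A}.

Record mvHom (A B : mvType) := MVHom {
  mvhom_fun :> A -> B;
  mvhom0 : mvhom_fun mv0 = mv0;
  mvhomN : {morph mvhom_fun : x / ¬ x};
  mvhomD : {morph mvhom_fun : x y / x ⊕ y}
}.

Lemma mvHom_eq (A B : mvType) (f g : mvHom A B) : f =1 g -> f = g.
Proof.
case: f g => [f f0 fN fD] [g g0 gN gD] /= /funext fg; subst g.
by congr MVHom; apply: Prop_irrelevance.
Qed.

Section MVTheory.
Variable A : mvType.
Implicit Types x y z t : A.

Lemma mv0add x : mv0 ⊕ x = x. Proof. by rewrite mvaddC mvadd0. Qed.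
Lemma mvadd1 x : x ⊕ mv1 = mv1. Proof. exact: mvaddn0. Qed.
Lemma mv1add x : mv1 ⊕ x = mv1. Proof. by rewrite mvaddC mvadd1. Qed.
Lemma mvneg1 : ¬ mv1 = mv0 :> A. Proof. exact: mvnegK. Qed.
Lemma mvneg0 : ¬ mv0 = mv1 :> A. Proof. by []. Qed.
Lemma mvaddAC x y z : x ⊕ y ⊕ z = x ⊕ z ⊕ y.
Proof. by rewrite -!mvaddA (mvaddC y). Qed.
Lemma mvaddCA x y z : x ⊕ (y ⊕ z) = y ⊕ (x ⊕ z).
Proof. by rewrite !mvaddA (mvaddC x). Qed.

Lemma mvaddN x : x ⊕ ¬ x = mv1.
Proof.
by have := mvadd_luk x (mv1 : A); rewrite mvneg1 mv0add !mvadd1 mvaddC => ->.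
Qed.

Lemma mvNadd x : ¬ x ⊕ x = mv1. Proof. by rewrite mvaddC mvaddN. Qed.

Lemma mvmulC x y : x ⊙ y = y ⊙ x. Proof. by rewrite /mvmul mvaddC. Qed.
Lemma mvmulA x y z : x ⊙ (y ⊙ z) = x ⊙ y ⊙ z.
Proof. by rewrite /mvmul !mvnegK mvaddA. Qed.
Lemma mvmul1 x : x ⊙ mv1 = x. Proof. by rewrite /mvmul mvneg1 mvadd0 mvnegK. Qed.
Lemma mv1mul x : mv1 ⊙ x = x. Proof. by rewrite mvmulC mvmul1. Qed.
Lemma mvmul0 x : x ⊙ mv0 = mv0. Proof. by rewrite /mvmul mvadd1 mvneg1. Qed.
Lemma mv0mul x : mv0 ⊙ x = mv0. Proof. by rewrite mvmulC mvmul0. Qed.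
Lemma mvmulN x : x ⊙ ¬ x = mv0. Proof. by rewrite /mvmul mvaddN mvneg1. Qed.

Lemma mvnegD x y : ¬ (x ⊕ y) = ¬ x ⊙ ¬ y. Proof. by rewrite /mvmul !mvnegK. Qed.
Lemma mvnegM x y : ¬ (x ⊙ y) = ¬ x ⊕ ¬ y. Proof. exact: mvnegK. Qed.

Lemma mvleP x y : reflect (¬ x ⊕ y = mv1) (x ≤ y). Proof. exact: eqP. Qed.

Lemma mvle_refl x : x ≤ x. Proof. by apply/mvleP/mvNadd. Qed.
Hint Resolve mvle_refl : core.

Lemma mvle_sub x y : x ≤ y -> (y ⊙ ¬ x) ⊕ x = y.
Proof.
move/mvleP=> xy; have := mvadd_luk x y.
by rewrite xy mvneg1 mv0add /mvmul mvnegK => <-.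
Qed.

Lemma mvle_addr x y : x ≤ x ⊕ y.
Proof. by apply/mvleP; rewrite mvaddA mvNadd mv1add. Qed.

Lemma mvle_addl x y : x ≤ y ⊕ x.
Proof. by rewrite mvaddC mvle_addr. Qed.

Lemma mvle_trans y x z : x ≤ y -> y ≤ z -> x ≤ z.
Proof.
move=> /mvle_sub <- /mvle_sub <-; rewrite (mvaddC _ x) mvaddC -mvaddA.
exact: mvle_addr.
Qed.

Lemma mvle_anti x y : x ≤ y -> y ≤ x -> x = y.
Proof.
move=> /mvleP xy /mvleP yx; have := mvadd_luk x y.
by rewrite xy yx mvneg1 !mv0add.
Qed.

Lemma mvle0 x : mv0 ≤ x. Proof. by rewrite -(mv0add x) mvle_addr. Qed.
Lemma mvle1 x : x ≤ mv1. Proof. by apply/mvleP/mvadd1. Qed.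
Hint Resolve mvle0 mvle1 : core.

Lemma mvleN x y : (¬ x ≤ ¬ y) = (y ≤ x).
Proof. by rewrite /mvle mvnegK mvaddC. Qed.

Lemma mvle_add2r z x y : x ≤ y -> x ⊕ z ≤ y ⊕ z.
Proof.
move=> /mvle_sub <-; rewrite -mvaddA mvle_addl //.
Qed.

Lemma mvle_add x y z t : x ≤ y -> z ≤ t -> x ⊕ z ≤ y ⊕ t.
Proof.
move=> xy zt; apply: (mvle_trans (mvle_add2r _ xy)).
by rewrite ![y ⊕ _]mvaddC mvle_add2r.
Qed.

Lemma mvle_mul x y z t : x ≤ y -> z ≤ t -> x ⊙ z ≤ y ⊙ t.
Proof. by move=> xy zt; rewrite mvleN mvle_add ?mvleN. Qed.

Lemma mvres x y z : (x ⊙ ¬ y ≤ z) = (x ≤ y ⊕ z).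
Proof. by rewrite /mvle mvnegM mvnegK mvaddA. Qed.

Lemma mvle_eq1 x : mv1 ≤ x -> x = mv1.
Proof. by move=> h; apply: mvle_anti. Qed.

Lemma mvle_eq0 x : x ≤ mv0 -> x = mv0.
Proof. by move=> h; apply: mvle_anti. Qed.

Lemma mvadd_eq1 x y : ¬ x ≤ y -> x ⊕ y = mv1.
Proof. by move/mvleP; rewrite mvnegK. Qed.

Lemma mvmul_eq0 x y : x ≤ ¬ y -> x ⊙ y = mv0.
Proof. by move/mvleP => h; rewrite /mvmul h mvneg1. Qed.

Lemma mvadd_eq1E x y : x ⊕ y = mv1 -> ¬ x ≤ y.
Proof. by move=> h; apply/mvleP; rewrite mvnegK. Qed.

Lemma mvmul_eq0E x y : x ⊙ y = mv0 -> x ≤ ¬ y.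
Proof. by move/(congr1 mvneg); rewrite mvnegM => /mvleP. Qed.

Lemma mvadd_cancel z x y : x ≤ ¬ z -> y ≤ ¬ z -> x ⊕ z = y ⊕ z -> x = y.
Proof.
have H t : t ≤ ¬ z -> t = (t ⊕ z) ⊙ ¬ z.
  rewrite -mvleN mvnegK => /mvle_sub h.
  by apply: (can_inj mvnegK); rewrite mvnegM mvnegK mvnegD h.
by move=> xz yz e; rewrite (H _ xz) e -(H _ yz).
Qed.

Definition mvjoin x y : A := (x ⊙ ¬ y) ⊕ y.
Definition mvmeet x y : A := ¬ mvjoin (¬ x) (¬ y).

Lemma mvjoinC x y : mvjoin x y = mvjoin y x.
Proof. by have := mvadd_luk x y; rewrite /mvjoin /mvmul !mvnegK. Qed.

Lemma mvjoin_r x y : x ≤ y -> mvjoin x y = y.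
Proof. by rewrite mvjoinC; apply: mvle_sub. Qed.

Lemma mvjoin_l x y : y ≤ x -> mvjoin x y = x.
Proof. exact: mvle_sub. Qed.

Lemma mvmeet_l x y : x ≤ y -> mvmeet x y = x.
Proof. by move=> xy; rewrite /mvmeet mvjoin_l ?mvnegK ?mvleN. Qed.

Lemma mvmeet_r x y : y ≤ x -> mvmeet x y = y.
Proof. by move=> xy; rewrite /mvmeet mvjoin_r ?mvnegK ?mvleN. Qed.

Lemma mvsub_trans x y z : x ⊙ ¬ z ≤ (x ⊙ ¬ y) ⊕ (y ⊙ ¬ z).
Proof.
have h (s t : A) : s ≤ t ⊕ (s ⊙ ¬ t) by rewrite -mvres.
rewrite mvres mvaddCA; apply: (mvle_trans (h x y)).
by rewrite mvaddC; apply: mvle_add.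
Qed.

Lemma mvsub_add x y z t : (x ⊕ y) ⊙ ¬ (z ⊕ t) ≤ (x ⊙ ¬ z) ⊕ (y ⊙ ¬ t).
Proof.
have h (s r : A) : s ≤ r ⊕ (s ⊙ ¬ r) by rewrite -mvres.
rewrite mvres -mvaddA (mvaddCA t) mvaddA.
exact: mvle_add.
Qed.

End MVTheory.
#[global] Hint Resolve mvle_refl mvle0 mvle1 : core.

Section MVHomTheory.
Variables (A B : mvType) (f : mvHom A B).
Lemma mvhom1 : f mv1 = mv1. Proof. by rewrite mvhomN mvhom0. Qed.
Lemma mvhomM : {morph f : x y / x ⊙ y}.
Proof. by move=> x y; rewrite mvhomN mvhomD !mvhomN. Qed.
Lemma mvhom_le x y : x ≤ y -> f x ≤ f y.
Proof. by move/mvleP => h; apply/mvleP; rewrite -mvhomN -mvhomD h mvhom1. Qed.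
End MVHomTheory.

Definition mvid (A : mvType) : mvHom A A :=
  @MVHom A A id erefl (fun=> erefl) (fun _ _ => erefl).

Section MVComp.
Variables (A B C : mvType) (g : mvHom B C) (f : mvHom A B).

Fact mvcomp0 : (g \o f) mv0 = mv0. Proof. by rewrite /= !mvhom0. Qed.
Fact mvcompN : {morph g \o f : x / ¬ x}.
Proof. by move=> x /=; rewrite !mvhomN. Qed.
Fact mvcompD : {morph g \o f : x y / x ⊕ y}.
Proof. by move=> x y /=; rewrite !mvhomD. Qed.

Definition mvcomp : mvHom A C := MVHom mvcomp0 mvcompN mvcompD.
End MVComp.

Record mvIdeal (A : mvType) := MVIdeal {
  mvideal_set :> A -> Prop;
  mvideal0 : mvideal_set mv0;
  mvideal_le : forall x y, x ≤ y -> mvideal_set y -> mvideal_set x;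
  mvidealD : forall x y, mvideal_set x -> mvideal_set y -> mvideal_set (x ⊕ y)
}.

Section MVQuotient.
Variables (A : mvType) (P : mvIdeal A).
Implicit Types x y z : A.

Definition mvcongr x y : bool := `[< P (x ⊙ ¬ y) /\ P (y ⊙ ¬ x) >].

Lemma mvcongr_equiv : equiv_class_of mvcongr.
Proof.
split=> [x|x y|y x z].
- by apply/asboolP; rewrite mvmulN; split; apply: mvideal0.
- by apply/asboolP/asboolP => -[].
- move=> /asboolP[xy yx] /asboolP[yz zy]; apply/asboolP; split.
    by apply: mvideal_le (mvsub_trans x y z) _; apply: mvidealD.
  by apply: mvideal_le (mvsub_trans z y x) _; apply: mvidealD.
Qed.

Canonical mvcongr_equivRel := EquivRelPack mvcongr_equiv.
Canonical mvcongr_encModRel := defaultEncModRel mvcongr.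

Definition mvquot := {eq_quot mvcongr}.
HB.instance Definition _ : EqQuotient A mvcongr mvquot := EqQuotient.on mvquot.
HB.instance Definition _ := Choice.on mvquot.

Lemma mvquotP x y : reflect (P (x ⊙ ¬ y) /\ P (y ⊙ ¬ x)) (x == y %[mod mvquot]).
Proof. by rewrite piE; apply: asboolP. Qed.

Definition mvquot0 : mvquot := lift_cst mvquot mv0.
Definition mvquotN : mvquot -> mvquot := lift_op1 mvquot mvneg.
Definition mvquotD : mvquot -> mvquot -> mvquot := lift_op2 mvquot mvadd.

Canonical pi_mvquot0_morph := PiConst mvquot0.

Lemma pi_mvquotN : {morph \pi_mvquot : x / ¬ x >-> mvquotN x}.
Proof.
move=> x; unlock mvquotN; apply/eqP/mvquotP.
have /eqP/mvquotP[h1 h2] : x = repr (\pi_mvquot x) %[mod mvquot] by rewrite reprK.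
by rewrite !mvnegK ![(¬ _) ⊙ _]mvmulC.
Qed.
Canonical pi_mvquotN_morph := PiMorph1 pi_mvquotN.

Lemma pi_mvquotD : {morph \pi_mvquot : x y / x ⊕ y >-> mvquotD x y}.
Proof.
move=> x y; unlock mvquotD; apply/eqP/mvquotP.
have /eqP/mvquotP[h1 h2] : x = repr (\pi_mvquot x) %[mod mvquot] by rewrite reprK.
have /eqP/mvquotP[h3 h4] : y = repr (\pi_mvquot y) %[mod mvquot] by rewrite reprK.
by split; apply: mvideal_le (mvsub_add _ _ _ _) _; apply: mvidealD.
Qed.
Canonical pi_mvquotD_morph := PiMorph2 pi_mvquotD.

Fact mvquotDA : associative mvquotD.
Proof. by move=> x y z; rewrite -[x]reprK -[y]reprK -[z]reprK !piE mvaddA. Qed.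
Fact mvquotDC : commutative mvquotD.
Proof. by move=> x y; rewrite -[x]reprK -[y]reprK !piE mvaddC. Qed.
Fact mvquotD0 : right_id mvquot0 mvquotD.
Proof. by move=> x; rewrite -[x]reprK !piE mvadd0. Qed.
Fact mvquotNK : involutive mvquotN.
Proof. by move=> x; rewrite -[x]reprK !piE mvnegK. Qed.
Fact mvquotDn0 (x : mvquot) : mvquotD x (mvquotN mvquot0) = mvquotN mvquot0.
Proof. by rewrite -[x]reprK !piE mvaddn0. Qed.
Fact mvquot_luk (x y : mvquot) :
  mvquotD (mvquotN (mvquotD (mvquotN x) y)) y
  = mvquotD (mvquotN (mvquotD (mvquotN y) x)) x.
Proof. by rewrite -[x]reprK -[y]reprK !piE mvadd_luk. Qed.

HB.instance Definition _ := isMV.Build mvquot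
  mvquotDA mvquotDC mvquotD0 mvquotNK mvquotDn0 mvquot_luk.

Lemma mvclass0 : \pi_mvquot mv0 = mv0. Proof. by rewrite [RHS]piE. Qed.
Lemma mvclassN : {morph \pi_mvquot : x / ¬ x}.
Proof. exact: pi_mvquotN. Qed.
Lemma mvclassD : {morph \pi_mvquot : x y / x ⊕ y}.
Proof. exact: pi_mvquotD. Qed.

Definition mvclass : mvHom A mvquot := MVHom mvclass0 mvclassN mvclassD.

Lemma mvclass_eq x y :
  mvclass x = mvclass y <-> P (x ⊙ ¬ y) /\ P (y ⊙ ¬ x).
Proof. by split=> [/eqP/mvquotP //|h]; apply/eqP/mvquotP. Qed.

Lemma mvclass_surj (q : mvquot) : exists x, q = mvclass x.
Proof. by exists (repr q); rewrite /= reprK. Qed.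

Lemma mvclass_le x y : mvclass x ≤ mvclass y <-> P (x ⊙ ¬ y).
Proof.
have -> : mvclass x ≤ mvclass y <-> mvclass (¬ x ⊕ y) = mvclass mv1.
  by rewrite mvhomD mvhomN mvhom1; split=> [/mvleP|h]; last apply/mvleP.
rewrite mvclass_eq mvneg1 mvmul0 mv1mul mvnegD mvnegK.
by split=> [[]//|h]; split=> //; apply: mvideal0.
Qed.

End MVQuotient.

(** Prime ideals of [A]: proper, with totally ordered quotient. *)
Record mvSp (A : mvType) := MVSp {
  mvsp_ideal :> mvIdeal A;
  mvsp_proper : mvideal_set mvsp_ideal <> [set: A];
  mvsp_total : total (@mvle (mvquot mvsp_ideal))
}.

(** The fiber [A / P] over a prime ideal [P], as an MV-chain. *)
Definition mvfiber (A : mvType) (P : mvSp A) : Type := mvquot P.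
HB.instance Definition _ (A : mvType) (P : mvSp A) := MV.on (mvfiber P).
HB.instance Definition _ (A : mvType) (P : mvSp A) :=
  isMVTotal.Build (mvfiber P) (@mvsp_total A P).

(** The class [a]_P as an element of the fiber. *)
Definition mvcls (A : mvType) (P : mvSp A) : mvHom A (mvfiber P) := mvclass P.

Section MVPreimage.
Variables (A B : mvType) (h : mvHom A B).

Section Ideal.
Variable P : mvIdeal B.

Fact mvpre0 : (P \o h) mv0. Proof. by rewrite /= mvhom0; apply: mvideal0. Qed.
Fact mvpre_le x y : x ≤ y -> (P \o h) y -> (P \o h) x.
Proof. by move=> xy; apply: mvideal_le; apply: mvhom_le. Qed.
Fact mvpreD x y : (P \o h) x -> (P \o h) y -> (P \o h) (x ⊕ y).
Proof. by move=> Px Py; rewrite /= mvhomD; apply: mvidealD. Qed.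

Definition mvpre_ideal : mvIdeal A := MVIdeal mvpre0 mvpre_le mvpreD.
End Ideal.

Variable P : mvSp B.

Fact mvpre_proper : mvideal_set (mvpre_ideal P) <> [set: A].
Proof.
move=> hP; apply: (@mvsp_proper _ P); apply/funext => x; apply/propext; split=> // _.
apply: mvideal_le (mvle1 x) _; rewrite -(mvhom1 h).
by suff : mvpre_ideal P mv1 by []; rewrite hP.
Qed.

Fact mvpre_total : total (@mvle (mvquot (mvpre_ideal P))).
Proof.
move=> p q; have [x ->] := mvclass_surj p; have [y ->] := mvclass_surj q.
have /orP[] := @mvsp_total _ P (mvclass P (h x)) (mvclass P (h y)).
  move/mvclass_le => H; apply/orP; left; apply/mvclass_le.
  by rewrite /= mvhomM mvhomN.
move/mvclass_le => H; apply/orP; right; apply/mvclass_le.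
by rewrite /= mvhomM mvhomN.
Qed.

(** [mvpre P] is the prime ideal [h^-1 P]. *)
Definition mvpre : mvSp A := MVSp mvpre_proper mvpre_total.

(** [mvrestr : A / h^-1 P -> B / P] maps the class of [a] to the class of
    [h a], see [mvrestrE]. *)
Definition mvrestr_fun (q : mvfiber mvpre) : mvfiber P := mvcls P (h (repr q)).

Fact mvrestr_funE x : mvrestr_fun (mvcls mvpre x) = mvcls P (h x).
Proof.
have : mvclass mvpre (repr (mvcls mvpre x)) = mvclass mvpre x by rewrite /= reprK.
move/mvclass_eq; rewrite /= !mvhomM !mvhomN => H.
exact/mvclass_eq.
Qed.

Fact mvcls_surj (Q : mvSp A) (q : mvfiber Q) : exists x, q = mvcls Q x.
Proof. exact: mvclass_surj. Qed.

Fact mvrestr0 : mvrestr_fun mv0 = mv0.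
Proof. by rewrite -(mvhom0 (mvcls mvpre)) mvrestr_funE !mvhom0. Qed.
Fact mvrestrN : {morph mvrestr_fun : x / ¬ x}.
Proof.
move=> p; have [x ->] := mvcls_surj p.
by rewrite -mvhomN !mvrestr_funE !mvhomN.
Qed.
Fact mvrestrD : {morph mvrestr_fun : x y / x ⊕ y}.
Proof.
move=> p q; have [x ->] := mvcls_surj p; have [y ->] := mvcls_surj q.
by rewrite -mvhomD !mvrestr_funE !mvhomD.
Qed.

Definition mvrestr : mvHom (mvfiber mvpre) (mvfiber P) :=
  MVHom mvrestr0 mvrestrN mvrestrD.

Lemma mvrestrE x : mvrestr (mvcls mvpre x) = mvcls P (h x).
Proof. exact: mvrestr_funE. Qed.

End MVPreimage.

(** The order and the group structure are those of the library's partially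
    ordered [porderZmodType]; binary suprema and infima are part of the
    structure and characterized by their universal properties.  A join with the
    library's [latticeType] is not possible, because the hierarchy has no common
    ancestor of [zmodType] and [latticeType] below [realDomainType]. *)
HB.mixin Record isLGroup G of Num.POrderedZmodule G := {
  lgjoin : G -> G -> G;
  lgmeet : G -> G -> G;
  lg_leUx : forall x y z : G, (lgjoin x y <= z) = (x <= z) && (y <= z);
  lg_lexI : forall x y z : G, (z <= lgmeet x y) = (z <= x) && (z <= y);
  lg_le_add2l : forall z x y : G, x <= y -> z + x <= z + y
}.

#[short(type="lgType")]
HB.structure Definition LGroup := {G of isLGroup G & Num.POrderedZmodule G}.

Notation "x ∨ y" := (lgjoin x y) (at level 52, left associativity) : ring_scope.
Notation "x ∧ y" := (lgmeet x y) (at level 48, left associativity) : ring_scope.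

Definition lgabs {G : lgType} (x : G) : G := (0 ∨ x) + (0 ∨ - x).

HB.mixin Record hasStrongUnit G of LGroup G := {
  lunit : G;
  lunit_ge0 : 0 <= lunit;
  lunit_strong : forall x : G, exists n : nat, lgabs x <= lunit *+ n
}.

#[short(type="luType")]
HB.structure Definition LuGroup := {G of hasStrongUnit G & LGroup G}.

HB.mixin Record isLuTotal G of LuGroup G := {
  lu_le_total : total (@Order.le ring_display G)
}.

#[short(type="luChainType")]
HB.structure Definition LuChain := {G of isLuTotal G & LuGroup G}.

Record luHom (G H : luType) := LuHom {
  luhom_fun :> G -> H;
  luhomD : {morph luhom_fun : x y / x + y};
  luhomU : {morph luhom_fun : x y / x ∨ y};
  luhomI : {morph luhom_fun : x y / x ∧ y};
  luhom1 : luhom_fun lunit = lunit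
}.

Lemma luHom_eq (G H : luType) (f g : luHom G H) : f =1 g -> f = g.
Proof.
case: f g => [f fD fU fI f1] [g gD gU gI g1] /= /funext fg; subst g.
by congr LuHom; apply: Prop_irrelevance.
Qed.

Definition luid (G : luType) : luHom G G :=
  @LuHom G G id (fun _ _ => erefl) (fun _ _ => erefl) (fun _ _ => erefl) erefl.

Section LuComp.
Variables (G H K : luType) (g : luHom H K) (f : luHom G H).

Fact lucompD : {morph g \o f : x y / x + y}.
Proof. by move=> x y /=; rewrite !luhomD. Qed.
Fact lucompU : {morph g \o f : x y / x ∨ y}.
Proof. by move=> x y /=; rewrite !luhomU. Qed.
Fact lucompI : {morph g \o f : x y / x ∧ y}.
Proof. by move=> x y /=; rewrite !luhomI. Qed.
Fact lucomp1 : (g \o f) lunit = lunit.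
Proof. by rewrite /= !luhom1. Qed.

Definition lucomp : luHom G K := LuHom lucompD lucompU lucompI lucomp1.
End LuComp.

Section LGLattice.
Variable G : lgType.
Implicit Types x y z : G.

Lemma lg_leUl x y : x <= x ∨ y.
Proof. by have := lexx (x ∨ y); rewrite lg_leUx => /andP[]. Qed.
Lemma lg_leUr x y : y <= x ∨ y.
Proof. by have := lexx (x ∨ y); rewrite lg_leUx => /andP[]. Qed.
Lemma lg_leIl x y : x ∧ y <= x.
Proof. by have := lexx (x ∧ y); rewrite lg_lexI => /andP[]. Qed.
Lemma lg_leIr x y : x ∧ y <= y.
Proof. by have := lexx (x ∧ y); rewrite lg_lexI => /andP[]. Qed.
Lemma lg_joinC x y : x ∨ y = y ∨ x.
Proof. by apply: le_anti; rewrite !lg_leUx !lg_leUl !lg_leUr. Qed.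
Lemma lg_meetC x y : x ∧ y = y ∧ x.
Proof. by apply: le_anti; rewrite !lg_lexI !lg_leIl !lg_leIr. Qed.
Lemma lg_join_r x y : x <= y -> x ∨ y = y.
Proof. by move=> xy; apply: le_anti; rewrite lg_leUx xy lexx lg_leUr. Qed.
Lemma lg_join_l x y : y <= x -> x ∨ y = x.
Proof. by move=> xy; rewrite lg_joinC lg_join_r. Qed.
Lemma lg_meet_l x y : x <= y -> x ∧ y = x.
Proof. by move=> xy; apply: le_anti; rewrite lg_lexI xy lexx lg_leIl. Qed.
Lemma lg_meet_r x y : y <= x -> x ∧ y = y.
Proof. by move=> xy; rewrite lg_meetC lg_meet_l. Qed.
Lemma lg_meetA x y z : x ∧ (y ∧ z) = x ∧ y ∧ z.
Proof.
have ub a b c : a ∧ (b ∧ c) <= (a : G) /\ a ∧ (b ∧ c) <= b /\ a ∧ (b ∧ c) <= c.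
  split; first exact: lg_leIl.
  by split; apply: (le_trans (lg_leIr _ _)); rewrite ?lg_leIl ?lg_leIr.
apply: le_anti; have [h1 [h2 h3]] := ub x y z.
rewrite !lg_lexI h1 h2 h3 /= lg_leIr andbT.
have [h4 [h5 h6]] := ub z x y; rewrite lg_meetC in h4 h5 h6.
by rewrite h5 h6.
Qed.
End LGLattice.

Section LuHomTheory.
Variables (G H : luType) (f : luHom G H).

Lemma luhom0 : f 0 = 0.
Proof. by apply: (addrI (f 0)); rewrite -luhomD !addr0. Qed.
Lemma luhomN : {morph f : x / - x}.
Proof. by move=> x; apply: (addrI (f x)); rewrite -luhomD !subrr luhom0. Qed.
Lemma luhomB : {morph f : x y / x - y}.
Proof. by move=> x y; rewrite luhomD luhomN. Qed.
Lemma luhom_le x y : x <= y -> f x <= f y.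
Proof. by move/lg_join_r => <-; rewrite luhomU lg_leUl. Qed.
End LuHomTheory.

Section LGroupTheory.
Variable G : lgType.
Implicit Types x y z t : G.

Lemma lg_leD2l z x y : (z + x <= z + y) = (x <= y).
Proof.
apply/idP/idP; last exact: lg_le_add2l.
by move/(lg_le_add2l (- z)); rewrite !addKr.
Qed.
Lemma lg_leD2r z x y : (x + z <= y + z) = (x <= y).
Proof. by rewrite ![_ + z]addrC lg_leD2l. Qed.
Lemma lg_leD x y z t : x <= y -> z <= t -> x + z <= y + t.
Proof. by move=> xy zt; apply: (@le_trans _ _ (y + z)); rewrite ?lg_leD2l ?lg_leD2r. Qed.
Lemma lg_leN x y : (- x <= - y) = (y <= x).
Proof. by rewrite -(lg_leD2l (x + y) (- x)) addrK [x + y - x]addrC addKr. Qed.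
Lemma lg_subr_ge0 x y : (0 <= y - x) = (x <= y).
Proof. by rewrite -(lg_leD2r x 0) add0r subrK. Qed.
Lemma lg_leBl x y z : (x - y <= z) = (x <= z + y).
Proof. by rewrite -(lg_leD2r y (x - y)) subrK. Qed.
Lemma lg_le_add0r x y : 0 <= y -> x <= x + y.
Proof. by move=> y0; rewrite -{1}[x]addr0 lg_leD2l. Qed.
Lemma lg_le_add0l x y : 0 <= y -> x <= y + x.
Proof. by move=> y0; rewrite addrC lg_le_add0r. Qed.
Lemma lg_addr_ge0 x y : 0 <= x -> 0 <= y -> 0 <= x + y.
Proof. by move=> x0 y0; rewrite -[0]addr0 lg_leD. Qed.

Lemma lg_mulrn_ge0 x n : 0 <= x -> 0 <= x *+ n.
Proof.
by move=> x0; elim: n => [|n IH]; rewrite ?mulr0n // mulrS lg_addr_ge0.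
Qed.
Lemma lg_mulrn_le x (m n : nat) : 0 <= x -> (m <= n)%N -> x *+ m <= x *+ n.
Proof. by move=> x0 /subnK <-; rewrite mulrnDr lg_le_add0l ?lg_mulrn_ge0. Qed.

Lemma lg_le_subr z x y : (z + x <= y) = (x <= y - z).
Proof. by rewrite addrC -(lg_leD2r z x) subrK. Qed.
Lemma lg_ge_subr z x y : (y <= z + x) = (y - z <= x).
Proof. by rewrite addrC -(lg_leD2r z (y - z)) subrK. Qed.

Lemma lg_joinDl z x y : z + (x ∨ y) = (z + x) ∨ (z + y).
Proof.
apply: le_anti; rewrite lg_leUx !lg_leD2l lg_leUl lg_leUr !andbT.
by rewrite lg_le_subr lg_leUx -!lg_le_subr lg_leUl lg_leUr.
Qed.
Lemma lg_joinDr z x y : (x ∨ y) + z = (x + z) ∨ (y + z).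
Proof. by rewrite addrC lg_joinDl ![z + _]addrC. Qed.
Lemma lg_meetDl z x y : z + (x ∧ y) = (z + x) ∧ (z + y).
Proof.
apply: le_anti; rewrite lg_lexI !lg_leD2l lg_leIl lg_leIr /=.
by rewrite lg_ge_subr lg_lexI -!lg_ge_subr lg_leIl lg_leIr.
Qed.
Lemma lg_meetDr z x y : (x ∧ y) + z = (x + z) ∧ (y + z).
Proof. by rewrite addrC lg_meetDl ![z + _]addrC. Qed.

Lemma lg_leNl x y : (- x <= y) = (- y <= x).
Proof. by rewrite -[y in LHS]opprK lg_leN. Qed.
Lemma lg_leNr x y : (x <= - y) = (y <= - x).
Proof. by rewrite -[x in LHS]opprK lg_leN. Qed.

Lemma lg_meetN x y : - (x ∧ y) = (- x) ∨ (- y).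
Proof.
apply: le_anti; rewrite lg_leUx !lg_leN lg_leIl lg_leIr !andbT.
by rewrite lg_leNl lg_lexI ![_ <= x]lg_leNl ![_ <= y]lg_leNl lg_leUl lg_leUr.
Qed.
Lemma lg_joinN x y : - (x ∨ y) = (- x) ∧ (- y).
Proof. by apply: (can_inj opprK); rewrite lg_meetN !opprK. Qed.

Lemma lg_pos_neg x : (0 ∨ x) - (0 ∨ - x) = x.
Proof.
apply/eqP; rewrite subr_eq lg_joinDl addr0 subrr; apply/eqP; exact: lg_joinC.
Qed.

Lemma lgabs_le u x (m n : nat) :
  0 <= u -> x <= u *+ m -> - x <= u *+ n -> lgabs x <= u *+ (m + n).
Proof.
by move=> u0 xm xn; rewrite mulrnDr lg_leD // lg_leUx lg_mulrn_ge0.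
Qed.

Lemma lgabs_bounds u x (n : nat) :
  lgabs x <= u *+ n -> (x <= u *+ n) && (- (u *+ n) <= x).
Proof.
have p y : (0 : G) <= 0 ∨ y by rewrite lg_leUl.
move=> h; apply/andP; split.
  by apply: le_trans h; apply: le_trans (lg_le_add0r _ (p _)); rewrite lg_leUr.
rewrite -lg_leN opprK; apply: le_trans h.
by apply: le_trans (lg_le_add0l _ (p _)); rewrite lg_leUr.
Qed.

End LGroupTheory.

Definition is_subgroup (V : zmodType) (H : set V) : Prop :=
  H 0 /\ forall x y, H x -> H y -> H (x - y).

Definition gen_subgroup (V : zmodType) (S : set V) : set V :=
  smallest (@is_subgroup V) S.

Lemma is_subgroupN (V : zmodType) (H : set V) x :
  is_subgroup H -> H x -> H (- x).
Proof. by case=> H0 HB Hx; rewrite -sub0r; apply: HB. Qed.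

Lemma is_subgroupD (V : zmodType) (H : set V) x y :
  is_subgroup H -> H x -> H y -> H (x + y).
Proof.
move=> hH Hx Hy; rewrite -[y]opprK; case: (hH) => _; apply=> //.
exact: is_subgroupN.
Qed.

Lemma gen_subgroupP (V : zmodType) (S : set V) : is_subgroup (gen_subgroup S).
Proof.
split=> [M [[]//]|x y Hx Hy M hM]; case: (hM) => -[_ MB] _; apply: MB.
  exact: Hx.
exact: Hy.
Qed.

Section Gamma.
Variable G : luType.

Record Gamma := MkGamma { gval :> G; gvalP : 0 <= gval <= lunit }.

HB.instance Definition _ := [isSub for gval].
HB.instance Definition _ := [Choice of Gamma by <:].

Implicit Types x y z : Gamma.

Lemma gval_ge0 x : 0 <= gval x. Proof. by case/andP: (gvalP x). Qed.
Lemma gval_le1 x : gval x <= lunit. Proof. by case/andP: (gvalP x). Qed.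
Hint Resolve gval_ge0 gval_le1 lunit_ge0 : core.

Fact gamma0_subproof : 0 <= (0 : G) <= lunit.
Proof. by rewrite lexx lunit_ge0. Qed.
Fact gammaN_subproof x : 0 <= lunit - gval x <= lunit.
Proof. by rewrite lg_subr_ge0 gval_le1 lg_leBl lg_le_add0r. Qed.
Fact gammaD_subproof x y : 0 <= lunit ∧ (gval x + gval y) <= lunit.
Proof. by rewrite lg_lexI lg_leIl lunit_ge0 lg_addr_ge0. Qed.

Definition gamma0 := MkGamma gamma0_subproof.
Definition gammaN x := MkGamma (gammaN_subproof x).
Definition gammaD x y := MkGamma (gammaD_subproof x y).

Fact gammaDA : associative gammaD.
Proof.
move=> x y z; apply: val_inj => /=.
rewrite lg_meetDl lg_meetDr addrA !lg_meetA.
by rewrite (lg_meet_l (lg_le_add0l _ (gval_ge0 _))) (lg_meet_l (lg_le_add0r _ (gval_ge0 _))).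
Qed.
Fact gammaDC : commutative gammaD.
Proof. by move=> x y; apply: val_inj => /=; rewrite addrC. Qed.
Fact gammaD0 : right_id gamma0 gammaD.
Proof. by move=> x; apply: val_inj => /=; rewrite addr0 lg_meet_r. Qed.
Fact gammaNK : involutive gammaN.
Proof. by move=> x; apply: val_inj => /=; rewrite subKr. Qed.
Fact gammaDn0 x : gammaD x (gammaN gamma0) = gammaN gamma0.
Proof. by apply: val_inj => /=; rewrite subr0 lg_meet_l // lg_le_add0l. Qed.
Fact gamma_joinE x y :
  gval (gammaD (gammaN (gammaD (gammaN x) y)) y) = gval x ∨ gval y.
Proof.
rewrite /= lg_meetN lg_joinDl subrr lg_joinDr add0r !opprD opprK.
rewrite !addrA subrr add0r subrK lg_joinC lg_meet_r // lg_leUx !gval_le1 //.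
Qed.
Fact gamma_luk x y :
  gammaD (gammaN (gammaD (gammaN x) y)) y
  = gammaD (gammaN (gammaD (gammaN y) x)) x.
Proof.
by apply: (val_inj : injective gval); rewrite !gamma_joinE lg_joinC.
Qed.

HB.instance Definition _ := isMV.Build Gamma
  gammaDA gammaDC gammaD0 gammaNK gammaDn0 gamma_luk.

Lemma gval0 : gval (mv0 : Gamma) = 0. Proof. by []. Qed.
Lemma gvalN x : gval (¬ x) = lunit - gval x. Proof. by []. Qed.
Lemma gvalD x y : gval (x ⊕ y) = lunit ∧ (gval x + gval y). Proof. by []. Qed.
Lemma gval1 : gval (mv1 : Gamma) = lunit. Proof. by rewrite gvalN gval0 subr0. Qed.
Lemma gval_inj : injective gval. Proof. exact: val_inj. Qed.

Lemma gvalM x y : gval (x ⊙ y) = 0 ∨ (gval x + gval y - lunit).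
Proof.
rewrite !gvalN gvalD !gvalN lg_meetN lg_joinDl subrr; congr (_ ∨ _).
by rewrite opprD !opprB addrA [lunit + _]addrC subrK addrA.
Qed.

Lemma gvalB x y : gval (x ⊙ ¬ y) = 0 ∨ (gval x - gval y).
Proof. by rewrite gvalM gvalN addrA addrAC addrK. Qed.

Lemma gamma_leE x y : (x ≤ y) = (gval x <= gval y).
Proof.
apply/mvleP/idP => [/(congr1 gval)|h].
  rewrite gval1 gvalD gvalN => e; have := lg_leIr lunit (lunit - gval x + gval y); rewrite e.
  by rewrite -addrA -[X in X <= _]addr0 lg_leD2l addrC lg_subr_ge0.
apply: gval_inj; rewrite gval1 gvalD gvalN; apply: lg_meet_l.
by rewrite -addrA -[X in X <= _]addr0 lg_leD2l addrC lg_subr_ge0.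
Qed.

End Gamma.
#[global] Hint Resolve gval_ge0 gval_le1 lunit_ge0 : core.

HB.instance Definition _ (G : luType) := MV.on (Gamma G).

Fact gamma_total (G : luChainType) : total (@mvle (Gamma G)).
Proof. by move=> x y; rewrite !gamma_leE; apply: lu_le_total. Qed.

HB.instance Definition _ (G : luChainType) :=
  isMVTotal.Build (Gamma G) (@gamma_total G).

Section GammaMap.
Variables (G H : luType) (f : luHom G H).

Fact gamma_map_subproof (x : Gamma G) : 0 <= f (gval x) <= lunit.
Proof.
apply/andP; split; first by rewrite -(luhom0 f); apply: luhom_le; apply: gval_ge0.
by rewrite -(luhom1 f); apply: luhom_le; apply: gval_le1.
Qed.

Definition Gamma_map_fun (x : Gamma G) : Gamma H := MkGamma (gamma_map_subproof x).

Fact Gamma_map0 : Gamma_map_fun mv0 = mv0.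
Proof. by apply: gval_inj; rewrite /= luhom0. Qed.
Fact Gamma_mapN : {morph Gamma_map_fun : x / ¬ x}.
Proof. by move=> x; apply: gval_inj; rewrite /= luhomB luhom1. Qed.
Fact Gamma_mapD : {morph Gamma_map_fun : x y / x ⊕ y}.
Proof. by move=> x y; apply: gval_inj; rewrite /= luhomI luhomD luhom1. Qed.

Definition Gamma_map : mvHom (Gamma G) (Gamma H) :=
  MVHom Gamma_map0 Gamma_mapN Gamma_mapD.
End GammaMap.

Record lIdeal (G : luType) := LIdeal {
  lideal_set :> G -> Prop;
  lideal_subgroup : is_subgroup lideal_set;
  lidealU : forall x y, lideal_set x -> lideal_set y -> lideal_set (x ∨ y);
  lidealI : forall x y, lideal_set x -> lideal_set y -> lideal_set (x ∧ y);
  lideal_convex : forall x y z, lideal_set x -> lideal_set z ->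
    x <= y -> y <= z -> lideal_set y
}.

Section LQuotient.
Variables (G : luType) (P : lIdeal G).
Implicit Types x y z : G.

Definition lideal_pred : {pred G} := fun x => `[< P x >].

Fact lideal_zmod_closed : zmod_closed lideal_pred.
Proof.
have [P0 PB] := lideal_subgroup P.
split=> [|x y]; first exact/asboolP.
by move=> /asboolP Px /asboolP Py; apply/asboolP; apply: PB.
Qed.
HB.instance Definition _ := GRing.isZmodClosed.Build G lideal_pred lideal_zmod_closed.

Lemma lideal0 : P 0. Proof. by case: (lideal_subgroup P). Qed.
Lemma lidealN x : P x -> P (- x).
Proof. exact: is_subgroupN (lideal_subgroup P). Qed.
Lemma lidealD x y : P x -> P y -> P (x + y).
Proof. exact: is_subgroupD (lideal_subgroup P). Qed.

Definition lquot : Type := Quotient.quot lideal_pred.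
HB.instance Definition _ := Choice.on lquot.
HB.instance Definition _ := GRing.Zmodule.on lquot.

Definition lclass x : lquot := \pi_(Quotient.quot lideal_pred) x.

Lemma lclass_surj (q : lquot) : exists x, q = lclass x.
Proof. by exists (repr q); rewrite /lclass reprK. Qed.

Lemma lclass_eq x y : lclass x = lclass y <-> P (x - y).
Proof.
split=> [/eqP|h]; last apply/eqP.
  by rewrite /lclass -Quotient.idealrBE => /asboolP.
by rewrite /lclass -Quotient.idealrBE; apply/asboolP.
Qed.

Lemma lclassD x y : lclass (x + y) = lclass x + lclass y.
Proof. exact: Quotient.pi_add. Qed.
Lemma lclassN x : lclass (- x) = - lclass x.
Proof. exact: Quotient.pi_opp. Qed.
Lemma lclass0 : lclass 0 = 0.
Proof. by apply: (addrI (lclass 0)); rewrite -lclassD !addr0. Qed.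
Lemma lclassMn x n : lclass (x *+ n) = lclass x *+ n.
Proof. by elim: n => [|n IH]; rewrite ?mulr0n ?lclass0 // !mulrS lclassD IH. Qed.

(** Two cosets are comparable when some of their representatives are. *)
Definition lquot_le (p q : lquot) : bool :=
  `[< exists x y, [/\ p = lclass x, q = lclass y & x <= y] >].

Lemma lquot_leE x y : lquot_le (lclass x) (lclass y) <-> exists2 p, P p & x <= y + p.
Proof.
split=> [/asboolP[x' [y' [/lclass_eq hx /lclass_eq hy xy]]]|[p Pp xy]].
  exists ((x - x') - (y - y')); first by apply: lidealD => //; apply: lidealN.
  rewrite opprB [y + _]addrC -addrA subrK.
  by rewrite -[X in X <= _](subrK x') lg_leD2l.
apply/asboolP; exists x, (y + p); split=> //.
by apply/lclass_eq; rewrite opprD addrA subrr add0r; apply: lidealN.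
Qed.

Fact lquot_le_refl : reflexive lquot_le.
Proof. by move=> p; have [x ->] := lclass_surj p; apply/asboolP; exists x, x. Qed.

Fact lquot_le_anti : antisymmetric lquot_le.
Proof.
move=> p q; have [x ->] := lclass_surj p; have [y ->] := lclass_surj q.
move=> /andP[/lquot_leE[a Pa xy] /lquot_leE[b Pb yx]].
apply/lclass_eq; apply: (@lideal_convex _ P (- b) _ a) => //.
- exact: lidealN.
- by rewrite lg_leNl opprB lg_leBl addrC.
- by rewrite lg_leBl addrC.
Qed.

Fact lquot_le_trans : transitive lquot_le.
Proof.
move=> q p r; have [x ->] := lclass_surj p; have [y ->] := lclass_surj q.
have [z ->] := lclass_surj r.
move=> /lquot_leE[a Pa xy] /lquot_leE[b Pb yz]; apply/lquot_leE.
exists (b + a); first exact: lidealD.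
by apply: (le_trans xy); rewrite addrA lg_leD2r.
Qed.

HB.instance Definition _ := Order.Le_isPOrder.Build ring_display lquot
  lquot_le_refl lquot_le_anti lquot_le_trans.

Lemma lclass_leE x y : (lclass x <= lclass y) <-> exists2 p, P p & x <= y + p.
Proof. exact: lquot_leE. Qed.

Lemma lclass_le x y : x <= y -> lclass x <= lclass y.
Proof. by move=> xy; apply/lclass_leE; exists 0; rewrite ?addr0 //; apply: lideal0. Qed.

Definition lquot_join (p q : lquot) : lquot := lclass (repr p ∨ repr q).
Definition lquot_meet (p q : lquot) : lquot := lclass (repr p ∧ repr q).

Lemma lclass_repr (q : lquot) : lclass (repr q) = q.
Proof. by rewrite /lclass reprK. Qed.

Fact lquot_leUx p q r : (lquot_join p q <= r) = (p <= r) && (q <= r).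
Proof.
rewrite -{2}(lclass_repr p) -{2}(lclass_repr q) -(lclass_repr r) /lquot_join.
move: (repr p) (repr q) (repr r) => x y z.
apply/idP/andP => [h|[/lclass_leE[a Pa xz] /lclass_leE[b Pb yz]]].
  by split; apply: le_trans h; apply: lclass_le; rewrite ?lg_leUl ?lg_leUr.
apply/lclass_leE; exists (a ∨ b); first exact: lidealU.
rewrite lg_leUx (le_trans xz) ?(le_trans yz) // lg_leD2l ?lg_leUl ?lg_leUr //.
Qed.

Fact lquot_lexI p q r : (r <= lquot_meet p q) = (r <= p) && (r <= q).
Proof.
rewrite -{2}(lclass_repr p) -{2}(lclass_repr q) -(lclass_repr r) /lquot_meet.
move: (repr p) (repr q) (repr r) => x y z.
apply/idP/andP => [h|[/lclass_leE[a Pa xz] /lclass_leE[b Pb yz]]].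
  by split; apply: (le_trans h); apply: lclass_le; rewrite ?lg_leIl ?lg_leIr.
apply/lclass_leE; exists (a ∨ b); first exact: lidealU.
rewrite lg_meetDr lg_lexI (le_trans xz) ?(le_trans yz) // lg_leD2l ?lg_leUl ?lg_leUr //.
Qed.

Fact lquot_le_add2l (r p q : lquot) : p <= q -> r + p <= r + q.
Proof.
have [x ->] := lclass_surj p; have [y ->] := lclass_surj q.
have [z ->] := lclass_surj r; rewrite -!lclassD.
move=> /lclass_leE[a Pa xy]; apply/lclass_leE; exists a => //.
by rewrite -addrA lg_leD2l.
Qed.

HB.instance Definition _ := isLGroup.Build lquot
  lquot_leUx lquot_lexI lquot_le_add2l.

Lemma lclassU x y : lclass (x ∨ y) = lclass x ∨ lclass y.
Proof.
have ub z : lclass x <= lclass z -> lclass y <= lclass z ->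
    lclass (x ∨ y) <= lclass z.
  move=> /lclass_leE[a Pa xa] /lclass_leE[b Pb yb].
  apply/lclass_leE; exists (a ∨ b); first exact: lidealU.
  rewrite lg_leUx (le_trans xa) ?(le_trans yb) // lg_leD2l ?lg_leUl ?lg_leUr //.
apply: le_anti; apply/andP; split.
  by rewrite -(lclass_repr (lclass x ∨ lclass y)); apply: ub;
     rewrite lclass_repr ?lg_leUl ?lg_leUr.
by rewrite lg_leUx; apply/andP; split; apply: lclass_le; rewrite ?lg_leUl ?lg_leUr.
Qed.

Lemma lclassI x y : lclass (x ∧ y) = lclass x ∧ lclass y.
Proof.
apply: (can_inj opprK).
by rewrite lg_meetN -!lclassN -lclassU lg_meetN.
Qed.

Fact lquot_unit_ge0 : 0 <= lclass lunit.
Proof. by rewrite -lclass0; apply/lclass_le/lunit_ge0. Qed.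

Fact lquot_unit_strong (p : lquot) : exists n : nat, lgabs p <= lclass lunit *+ n.
Proof.
have [x ->] := lclass_surj p; have [n xn] := lunit_strong x; exists n.
rewrite -lclassMn; have := lclass_le xn.
by rewrite /lgabs lclassD !lclassU lclassN lclass0.
Qed.

HB.instance Definition _ := hasStrongUnit.Build lquot
  lquot_unit_ge0 lquot_unit_strong.

Lemma lclass1 : lclass lunit = lunit. Proof. by []. Qed.

Definition lclass_hom : luHom G lquot := LuHom lclassD lclassU lclassI lclass1.

End LQuotient.

(** Prime [l]-ideals of [G]: proper, with totally ordered quotient. *)
Record lSp (G : luType) := LSp {
  lsp_ideal :> lIdeal G;
  lsp_proper : lideal_set lsp_ideal <> [set: G];
  lsp_total : total (@Order.le ring_display (lquot lsp_ideal))
}.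

(** The fiber [G / P] over a prime [l]-ideal [P], as an [l_u]-chain. *)
Definition lfiber (G : luType) (P : lSp G) : Type := lquot P.
HB.instance Definition _ (G : luType) (P : lSp G) := LuGroup.on (lfiber P).
HB.instance Definition _ (G : luType) (P : lSp G) :=
  isLuTotal.Build (lfiber P) (@lsp_total G P).

(** The class [x]_P as an element of the fiber *)
Definition lcls (G : luType) (P : lSp G) : luHom G (lfiber P) := lclass_hom P.

Section Trace.
Variables (G : luType) (P : lSp G).
Implicit Types x y : Gamma G.

(** The trace [P ∩ [0, u]] of a prime [l]-ideal is a prime ideal. *)
Definition ltrace_set x : Prop := P (gval x).

Fact ltrace0 : ltrace_set mv0. Proof. exact: lideal0. Qed.
Fact ltrace_le x y : x ≤ y -> ltrace_set y -> ltrace_set x.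
Proof.
rewrite gamma_leE => xy Py; exact: lideal_convex (lideal0 P) Py (gval_ge0 x) xy.
Qed.
Fact ltraceD x y : ltrace_set x -> ltrace_set y -> ltrace_set (x ⊕ y).
Proof.
move=> Px Py; apply: (lideal_convex (lideal0 P) (lidealD Px Py)).
  exact: gval_ge0.
exact: lg_leIr.
Qed.

Definition ltrace_ideal : mvIdeal (Gamma G) := MVIdeal ltrace0 ltrace_le ltraceD.

Fact ltrace_proper : mvideal_set ltrace_ideal <> [set: Gamma G].
Proof.
move=> hP; apply: (@lsp_proper _ P); apply/funext => x; apply/propext; split=> // _.
have Pu : P lunit.
  have : ltrace_ideal mv1 by rewrite hP.
  by rewrite /= /ltrace_set gval1.
have Pn n : P (lunit *+ n).
  by elim: n => [|n IH]; [exact: lideal0 | rewrite mulrS; apply: lidealD].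
have [n xn] := lunit_strong x; have /andP[h1 h2] := lgabs_bounds xn.
exact: (lideal_convex (lidealN (Pn n)) (Pn n)).
Qed.

Lemma ltrace_cls_le x y : lcls P (gval x) <= lcls P (gval y) -> ltrace_set (x ⊙ ¬ y).
Proof.
move/lclass_leE => [p Pp xy]; rewrite /ltrace_set gvalB.
apply: (lideal_convex (lideal0 P) (lidealU (lideal0 P) Pp)).
  by rewrite lg_leUl.
rewrite lg_leUx lg_leUl; apply: le_trans (lg_leUr _ _).
by rewrite lg_leBl addrC.
Qed.

Fact ltrace_total : total (@mvle (mvquot ltrace_ideal)).
Proof.
move=> p q; have [x ->] := mvclass_surj p; have [y ->] := mvclass_surj q.
have /orP[h|h] := lu_le_total (lcls P (gval x)) (lcls P (gval y)).
  by apply/orP; left; apply/mvclass_le/ltrace_cls_le.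
by apply/orP; right; apply/mvclass_le/ltrace_cls_le.
Qed.

Definition ltrace : mvSp (Gamma G) := MVSp ltrace_proper ltrace_total.

(** [gident : Γ(G,u) / (P ∩ [0,u]) -> Γ(G/P, [u]_P)] maps the class of [x]
    to the class of [x], see [gidentE]. *)
Definition gident_fun (q : mvfiber ltrace) : Gamma (lfiber P) :=
  Gamma_map (lcls P) (repr q).

Fact gident_funE x : gident_fun (mvcls ltrace x) = Gamma_map (lcls P) x.
Proof.
have : mvcls ltrace (repr (mvcls ltrace x)) = mvcls ltrace x.
  by rewrite /mvcls /= reprK.
rewrite /gident_fun; move: (repr _) => y /mvclass_eq[].
rewrite /= /ltrace_set !gvalB => h1 h2.
apply: gval_inj; apply/lclass_eq.
rewrite -[_ - _]lg_pos_neg opprB.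
exact: (lidealD h1 (lidealN h2)).
Qed.

Fact gident0 : gident_fun mv0 = mv0.
Proof. by rewrite -(mvhom0 (mvcls ltrace)) gident_funE mvhom0. Qed.
Fact gidentN : {morph gident_fun : x / ¬ x}.
Proof.
move=> p; have [x ->] := mvcls_surj p.
by rewrite -mvhomN !gident_funE mvhomN.
Qed.
Fact gidentD : {morph gident_fun : x y / x ⊕ y}.
Proof.
move=> p q; have [x ->] := mvcls_surj p; have [y ->] := mvcls_surj q.
by rewrite -mvhomD !gident_funE mvhomD.
Qed.

Definition gident : mvHom (mvfiber ltrace) (Gamma (lfiber P)) :=
  MVHom gident0 gidentN gidentD.

Lemma gidentE x : gident (mvcls ltrace x) = Gamma_map (lcls P) x.
Proof. exact: gident_funE. Qed.

End Trace.

Section ChRaw.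
Variable C : mvType.

(** The identification of [(m + 1, 0)] with [(m, 1)] *)
Definition chstep (p q : int * C) : Prop :=
  exists m : int, p = (m + 1, mv0) /\ q = (m, mv1).

Definition chrel (p q : int * C) : bool :=
  `[< clos_refl_sym_trans (int * C) chstep p q >].

Lemma chrel_equiv : equiv_class_of chrel.
Proof.
split=> [p|p q|q p r]; first by apply/asboolP/rst_refl.
  by apply/asboolP/asboolP => h; apply: rst_sym.
by move=> /asboolP h1 /asboolP h2; apply/asboolP/rst_trans/h2.
Qed.

Canonical chrel_equivRel := EquivRelPack chrel_equiv.
Canonical chrel_encModRel := defaultEncModRel chrel.

Definition Ch := {eq_quot chrel}.
HB.instance Definition _ : EqQuotient (int * C)%type chrel Ch := EqQuotient.on Ch.
HB.instance Definition _ := Choice.on Ch.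

(** The element [(m, a)] of [Ch C] *)
Definition chpair (m : int) (a : C) : Ch := \pi_Ch (m, a).

Definition chadd (p q : int * C) : int * C :=
  if p.2 ⊕ q.2 == mv1 then (p.1 + q.1 + 1, p.2 ⊙ q.2)
  else (p.1 + q.1, p.2 ⊕ q.2).

Definition chopp (p : int * C) : int * C := (- p.1 - 1, ¬ p.2).

Definition chlex (p q : int * C) : bool :=
  (p.1 < q.1) || (p.1 == q.1) && (p.2 ≤ q.2).

(** Coordinates: [chco (m, a)] is [1] before [m], [a] at [m] and [0] after [m].
    Two pairs are identified iff they have the same coordinates. *)
Definition chco (p : int * C) (k : int) : C :=
  if k < p.1 then mv1 else if k == p.1 then p.2 else mv0.

Lemma chco_lt p k : k < p.1 -> chco p k = mv1.
Proof. by rewrite /chco => ->. Qed.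
Lemma chco_eq p k : k = p.1 -> chco p k = p.2.
Proof. by rewrite /chco => ->; rewrite ltxx eqxx. Qed.
Lemma chco_gt p k : p.1 < k -> chco p k = mv0.
Proof.
by move=> h; rewrite /chco ltNge (ltW h) /= gt_eqF.
Qed.

Lemma chstep_co p q : chstep p q -> chco p =1 chco q.
Proof.
move=> [m [-> ->]] k; have [h|h|h] := ltgtP k m.
- by rewrite !chco_lt //=; lia.
- have [h'|h'] : k = m + 1 \/ m + 1 < k by lia.
    by rewrite chco_eq // chco_gt.
  by rewrite !chco_gt.
- by rewrite (chco_lt (p := (m + 1, _))) ?chco_eq //=; lia.
Qed.

Lemma chrelP p q : reflect (chco p =1 chco q) (chrel p q).
Proof.
apply: (iffP idP) => [/asboolP|pq].
  elim=> [{}p {}q|{}p|{}p {}q _ h|{}p {}q r _ h1 _ h2].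
  - exact: chstep_co.
  - by [].
  - by move=> k; rewrite h.
  - by move=> k; rewrite h1 h2.
apply/asboolP; case: p q pq => [m a] [n b] /= pq.
have [t|nt] := eqVneq (mv1 : C) mv0.
  have z (x : C) : x = mv0 by apply: mvle_eq0; rewrite -t.
  have steps (k : int) (d : nat) :
      clos_refl_sym_trans _ chstep (k + d%:Z, mv0) (k, mv0).
    elim: d => [|d IH]; first by rewrite addr0; apply: rst_refl.
    apply: rst_trans IH; apply: rst_step; exists (k + d%:Z).
    by rewrite t -addrA -PoszD addn1.
  rewrite (z a) (z b); case: (lerP n m) => h.
    by rewrite -(subrK n m) -(gez0_abs (_ : 0 <= m - n)) ?subr_ge0 // addrC.
  apply: rst_sym; rewrite -(subrK m n) -(gez0_abs (_ : 0 <= n - m)) ?subr_ge0 ?ltW //.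
  by rewrite addrC.
have aux m1 m2 (x y : C) : m1 < m2 -> chco (m1, x) =1 chco (m2, y) ->
    clos_refl_sym_trans _ chstep (m1, x) (m2, y).
  move=> lt12 h; have := h m1; rewrite chco_eq // chco_lt //= => ->.
  have [e|lt12'] : m2 = m1 + 1 \/ m1 + 1 < m2 by lia.
    have := h m2; rewrite chco_gt // chco_eq //= => <-.
    by apply: rst_sym; apply: rst_step; exists m1; rewrite e.
  have := h (m1 + 1); rewrite chco_gt ?chco_lt //=; last by lia.
  by move=> e; rewrite e eqxx in nt.
have [lt|lt|e] := ltgtP m n; first exact: aux.
  by apply: rst_sym; apply: aux.
by have := pq m; rewrite chco_eq // chco_eq //= e => ->; apply: rst_refl.
Qed.

Definition chc (x : Ch) : int -> C := chco (repr x).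

Lemma chc_pi p : chc (\pi_Ch p) =1 chco p.
Proof.
by apply/chrelP; have := reprK (\pi_Ch p) => /eqP; rewrite piE.
Qed.

Lemma chc_pair m a : chc (chpair m a) =1 chco (m, a).
Proof. exact: chc_pi. Qed.

Lemma chc_inj x y : chc x =1 chc y -> x = y.
Proof.
move=> h; rewrite -[x]reprK -[y]reprK; apply/eqP.
by rewrite piE; apply/chrelP.
Qed.

Lemma chpair_repr x : x = chpair (repr x).1 (repr x).2.
Proof. by rewrite /chpair -surjective_pairing reprK. Qed.

Lemma chpair_step m : chpair (m + 1) mv0 = chpair m mv1.
Proof.
by apply: chc_inj => k; rewrite !chc_pair; apply: chstep_co; exists m.
Qed.

Lemma chco_opp p k : chco (chopp p) k = ¬ chco p (- k - 1).
Proof.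
case: p => m a; have [h|h|h] := ltgtP k (- m - 1).
- rewrite chco_lt //= chco_gt //=; lia.
- by rewrite chco_gt //= chco_lt ?mvneg1 //=; lia.
- by rewrite chco_eq //= chco_eq //= h; lia.
Qed.

Lemma chaddC p q : chadd p q = chadd q p.
Proof.
by rewrite /chadd mvaddC [p.1 + _]addrC [p.2 ⊙ _]mvmulC.
Qed.

End ChRaw.

Section MVChainTheory.
Variable C : mvChainType.
Implicit Types a b c : C.

Lemma mvchain_dich a b : a ⊕ b = mv1 \/ a ⊙ b = mv0.
Proof.
case/orP: (mvle_total (¬ a) b) => h; first by left; apply: mvadd_eq1.
by right; rewrite mvmulC; apply: mvmul_eq0.
Qed.

Lemma mvchain_E1 a b c : a ⊕ b = mv1 -> b ⊙ c = mv0 ->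
  (a ⊙ b) ⊕ c = a ⊙ (b ⊕ c).
Proof.
move=> ab bc.
have nab : ¬ a ≤ b by apply: mvadd_eq1E.
have cnb : c ≤ ¬ b by apply: mvmul_eq0E; rewrite mvmulC.
have nba : ¬ b ≤ a by rewrite -mvleN mvnegK.
have jb : (b ⊙ a) ⊕ ¬ a = b by rewrite -{1}[a]mvnegK; apply: mvle_sub.
have ja : (a ⊙ b) ⊕ ¬ b = a by rewrite -{1}[b]mvnegK; apply: mvle_sub.
have jbc : ((b ⊕ c) ⊙ a) ⊕ ¬ a = b ⊕ c.
  rewrite -{1}[a]mvnegK; apply: mvle_sub.
  by apply: mvle_trans nab (mvle_addr _ _).
apply: (@mvadd_cancel _ (¬ a)); rewrite ?mvnegK.
- by rewrite -{2}ja; apply: mvle_add.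
- by rewrite -{2}[a]mvmul1; apply: mvle_mul.
- by rewrite mvaddAC (mvmulC a) jb (mvmulC a) jbc.
Qed.

Lemma mvchain_E2 a b c : a ⊙ b = mv0 -> b ⊙ c = mv0 ->
  (a ⊕ b) ⊙ c = a ⊙ (b ⊕ c).
Proof.
move=> ab bc.
have [abc|nabc] := eqVneq (a ⊕ b ⊕ c) mv1; last first.
  have [e|->] := mvchain_dich (a ⊕ b) c; first by rewrite e eqxx in nabc.
  by have [e|-> //] := mvchain_dich a (b ⊕ c); rewrite mvaddA in e; rewrite e eqxx in nabc.
apply: (@mvadd_cancel _ b).
- rewrite -[¬ b]mv1mul; apply: mvle_mul => //.
  by apply: mvmul_eq0E; rewrite mvmulC.
- rewrite -[¬ b]mvmul1; apply: mvle_mul => //.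
  exact: mvmul_eq0E.
rewrite mvchain_E1 //; last by rewrite mvmulC.
rewrite [in RHS]mvmulC mvchain_E1 //; last by rewrite mvaddC mvaddA.
by rewrite mvmulC (mvaddC c).
Qed.

Lemma mvchain_key a b c : (a ⊙ b) ⊕ ((a ⊕ b) ⊙ c) =
  if b ⊕ c == mv1 then a ⊕ (b ⊙ c) else a ⊙ (b ⊕ c).
Proof.
have N (x y : C) : ¬ x = ¬ y -> x = y by apply: (can_inj (@mvnegK C)).
case: eqP => bc; have [ab|ab] := mvchain_dich a b; rewrite ab ?mv1mul ?mv0add.
- apply: N; rewrite mvnegD mvnegM mvnegD mvnegM.
  apply: mvchain_E2; last by rewrite -mvnegD bc mvneg1.
  by rewrite -mvnegD ab mvneg1.
- apply: N; rewrite mvnegM mvnegD mvnegD mvnegM.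
  apply: mvchain_E1; last by rewrite -mvnegD bc mvneg1.
  by rewrite -mvnegM ab.
- apply: mvchain_E1 => //; by case: (mvchain_dich b c).
- apply: mvchain_E2 => //; by case: (mvchain_dich b c).
Qed.

Lemma chco_add (p : int * C) n b k :
  chco (chadd p (n, b)) k = chco p (k - n) ⊕ (chco p (k - n - 1) ⊙ b).
Proof.
case: p => m a; rewrite /chadd /=.
have [h|[h|[h|h]]] : k - n < m \/ k - n = m \/ k - n = m + 1 \/ m + 1 < k - n by lia.
- rewrite (chco_lt (p := (m, a))) // mv1add.
  by case: ifP => _; rewrite chco_lt //=; lia.
- rewrite (chco_eq (p := (m, a))) // (chco_lt (p := (m, a))) /=; last by lia.
  rewrite mv1mul; case: eqP => ab; first by rewrite chco_lt ?ab //=; lia.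
  by rewrite chco_eq //=; lia.
- rewrite (chco_gt (p := (m, a))) /=; last by lia.
  rewrite mv0add (chco_eq (p := (m, a))) /=; last by lia.
  case: eqP => ab; first by rewrite chco_eq //=; lia.
  rewrite chco_gt /=; last by lia.
  by case: (mvchain_dich a b).
- rewrite !(chco_gt (p := (m, a))) /=; [|lia|lia].
  by rewrite mv0mul mv0add; case: ifP => _; rewrite chco_gt //=; lia.
Qed.

Lemma chaddA_co (p q r : int * C) :
  chco (chadd (chadd p q) r) =1 chco (chadd p (chadd q r)).
Proof.
case: p q r => [m a] [n b] [l c] k; rewrite !chco_add.
have -> : chadd (n, b) (l, c) =
  if b ⊕ c == mv1 then (n + l + 1, b ⊙ c) else (n + l, b ⊕ c) by [].
rewrite (_ : k - l - 1 - n = k - l - n - 1); last by lia.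
set RHSof := RHS; have -> : RHSof = if b ⊕ c == mv1
  then chco (m, a) (k - (n + l + 1)) ⊕ (chco (m, a) (k - (n + l + 1) - 1) ⊙ (b ⊙ c))
  else chco (m, a) (k - (n + l)) ⊕ (chco (m, a) (k - (n + l) - 1) ⊙ (b ⊕ c)).
  by rewrite /RHSof; case: ifP.
clear RHSof.
rewrite (_ : k - (n + l + 1) = k - l - n - 1); last by lia.
rewrite (_ : k - (n + l) = k - l - n); last by lia.
move: (k - l - n) => j {k}.
have [h|[h|[h|[h|h]]]] :
  j < m \/ j = m \/ j = m + 1 \/ j = m + 2 \/ m + 2 < j by lia.
- by rewrite !chco_lt ?mv1add ?if_same //=; lia.
- rewrite chco_eq // !chco_lt /=; try lia.
  rewrite !mv1mul !mv1add mv1mul -mvaddA.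
  by case: eqP => // ->; rewrite mvadd1.
- rewrite chco_gt /=; last by lia.
  rewrite (chco_eq (k := j - 1)) /=; last by lia.
  rewrite (chco_lt (k := j - 1 - 1)) /=; last by lia.
  by rewrite !mv0add mv1mul mvchain_key mv1mul.
- rewrite !(chco_gt (k := j)) /=; last by lia.
  rewrite !(chco_gt (k := j - 1)) /=; last by lia.
  rewrite (chco_eq (k := j - 1 - 1)) /=; last by lia.
  rewrite !mv0mul !mv0add; case: eqP => bc; first by rewrite mvmulA.
  have [//|bc0] := mvchain_dich b c.
  by rewrite -mvmulA bc0 mvmul0.
- by rewrite !chco_gt ?mv0mul ?mv0add ?mv0mul ?if_same //=; lia.
Qed.

Lemma chco_le_add (p q r : int * C) :
  (forall k, chco p k ≤ chco q k) ->
  forall k, chco (chadd r p) k ≤ chco (chadd r q) k.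
Proof.
move=> pq k; rewrite ![chadd r _]chaddC; case: r => n b; rewrite !chco_add.
by apply: mvle_add => //; apply: mvle_mul.
Qed.

Lemma chadd_wd (p p' q q' : int * C) : chco p =1 chco p' -> chco q =1 chco q' ->
  chco (chadd p q) =1 chco (chadd p' q').
Proof.
move=> pp qq k; case: q qq => n b qq; rewrite chco_add !pp -chco_add.
rewrite chaddC [in RHS]chaddC; case: p' {pp} => n' b'.
by rewrite !chco_add !qq.
Qed.

End MVChainTheory.

Section ChGroup.
Variable C : mvChainType.
Implicit Types x y z : Ch C.

Definition ch0 : Ch C := chpair 0 mv0.
Definition chD : Ch C -> Ch C -> Ch C := lift_op2 (Ch C) (@chadd C).
Definition chN : Ch C -> Ch C := lift_op1 (Ch C) (@chopp C).
Definition chle x y : bool :=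
  `[< exists p q : int * C, [/\ x = \pi p, y = \pi q & chlex p q] >].
Definition chjoin x y : Ch C := if chle x y then y else x.
Definition chmeet x y : Ch C := if chle x y then x else y.

Lemma pi_chD : {morph \pi_(Ch C) : p q / chadd p q >-> chD p q}.
Proof.
move=> p q; unlock chD; apply/eqP; rewrite piE; apply/chrelP.
by apply: chadd_wd => k; rewrite -[LHS]chc_pi.
Qed.

Lemma pi_chN : {morph \pi_(Ch C) : p / chopp p >-> chN p}.
Proof.
move=> p; unlock chN; apply/eqP; rewrite piE; apply/chrelP => k.
by rewrite !chco_opp -[in LHS]chc_pi.
Qed.

Fact chDA : associative chD.
Proof.
move=> x y z; rewrite -[x]reprK -[y]reprK -[z]reprK -!pi_chD.
by apply: chc_inj => k; rewrite !chc_pi chaddA_co.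
Qed.
Fact chDC : commutative chD.
Proof. by move=> x y; rewrite -[x]reprK -[y]reprK -!pi_chD chaddC. Qed.
Fact ch0D : left_id ch0 chD.
Proof.
move=> x; rewrite -[x]reprK -!pi_chD chaddC.
apply: chc_inj => k; rewrite !chc_pi chco_add subr0 mvmul0 mvadd0 //.
Qed.
Fact chND : left_inverse ch0 chN chD.
Proof.
move=> x; rewrite -[x]reprK -!pi_chN -!pi_chD; congr (\pi_(Ch C) _).
case: (repr x) => m a; rewrite /chadd /= mvNadd eqxx mvmulC mvmulN.
by congr pair; lia.
Qed.

HB.instance Definition _ := GRing.isZmodule.Build (Ch C) chDA chDC ch0D chND.

Lemma chleP x y : reflect (forall k, chc x k ≤ chc y k) (chle x y).
Proof.
have lexco (p q : int * C) k : chlex p q -> chco p k ≤ chco q k.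
  case: p q => [m a] [n b]; rewrite /chlex /= => /orP[mn|/andP[/eqP <- ab]].
    have [h|h] := ltP k n; first by rewrite (chco_lt (p := (n, b))).
    by rewrite chco_gt //=; lia.
  by rewrite /chco /=; case: ifP => // _; case: ifP.
apply: (iffP idP) => [/asboolP[p [q [-> -> pq]]] k|h].
  by rewrite !chc_pi; apply: lexco.
have [pq|/negbTE npq] := boolP (chlex (repr x) (repr y)).
  by apply/asboolP; exists (repr x), (repr y); rewrite !reprK.
have qp : chlex (repr y) (repr x).
  move: npq; rewrite /chlex; case: (repr x) (repr y) => [m a] [n b] /=.
  case: ltgtP => //= _; case/orP: (mvle_total a b) => // ->//.
have -> : x = y.
  by apply: chc_inj => k; apply: mvle_anti; [apply: h | apply: lexco].
apply/asboolP; exists (repr y), (repr y); rewrite !reprK; split=> //.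
by rewrite /chlex eqxx mvle_refl orbT.
Qed.

Fact chle_refl : reflexive chle.
Proof. by move=> x; apply/chleP. Qed.
Fact chle_anti : antisymmetric chle.
Proof.
move=> x y /andP[/chleP xy /chleP yx].
by apply: chc_inj => k; apply: mvle_anti.
Qed.
Fact chle_trans : transitive chle.
Proof.
move=> y x z /chleP xy /chleP yz; apply/chleP => k.
exact: mvle_trans (xy k) (yz k).
Qed.
Fact chle_total : total chle.
Proof.
move=> x y; have [//|nxy] := boolP (chle x y); apply/asboolP.
exists (repr y), (repr x); rewrite !reprK; split=> //.
have : ~~ chlex (repr x) (repr y).
  by apply: contra nxy => h; apply/asboolP; exists (repr x), (repr y); rewrite !reprK.
rewrite /chlex; case: (repr x) (repr y) => [m a] [n b] /=.
by case: ltgtP => //= _; case/orP: (mvle_total a b) => // ->.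
Qed.

HB.instance Definition _ := Order.Le_isPOrder.Build ring_display (Ch C)
  chle_refl chle_anti chle_trans.

Fact ch_leUx x y z : (chjoin x y <= z) = (x <= z) && (y <= z).
Proof.
rewrite /chjoin; case: ifP => xy.
  by have [yz|] := boolP (y <= z); rewrite ?andbF // (@le_trans _ _ y).
have yx : y <= x by have := chle_total x y; rewrite xy.
by have [xz|] := boolP (x <= z) => //=; rewrite (le_trans yx xz).
Qed.
Fact ch_lexI x y z : (z <= chmeet x y) = (z <= x) && (z <= y).
Proof.
rewrite /chmeet; case: ifP => xy.
  by have [zx|] := boolP (z <= x) => //=; rewrite (le_trans zx).
have yx : y <= x by have := chle_total x y; rewrite xy.
by have [zy|] := boolP (z <= y); rewrite ?andbF // (le_trans zy yx).
Qed.
Fact ch_le_add2l z x y : x <= y -> z + x <= z + y.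
Proof.
move=> /chleP xy; apply/chleP => k.
rewrite -[x]reprK -[y]reprK -[z]reprK -[_ + _]pi_chD -[X in _ ≤ chc X _]pi_chD.
by rewrite !chc_pi; apply: chco_le_add.
Qed.

HB.instance Definition _ := isLGroup.Build (Ch C) ch_leUx ch_lexI ch_le_add2l.

Lemma chpairD m n (a b : C) : chpair m a + chpair n b =
  if a ⊕ b == mv1 then chpair (m + n + 1) (a ⊙ b) else chpair (m + n) (a ⊕ b).
Proof. by rewrite -[LHS]pi_chD /chadd /=; case: ifP. Qed.

Lemma chpairN m (a : C) : - chpair m a = chpair (- m - 1) (¬ a).
Proof. by rewrite -[LHS]pi_chN. Qed.

Lemma chc_addr x n (b : C) k :
  chc (x + chpair n b) k = chc x (k - n) ⊕ (chc x (k - n - 1) ⊙ b).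
Proof. by rewrite -{1}[x]reprK -[_ + _]pi_chD chc_pi chco_add. Qed.

Lemma chc_opp x k : chc (- x) k = ¬ chc x (- k - 1).
Proof. by rewrite -{1}[x]reprK -[- _]pi_chN chc_pi chco_opp. Qed.

Definition ch_unit : Ch C := chpair 0 mv1.

Lemma chpair_unit : ch_unit = chpair 1 mv0.
Proof. by rewrite -[1]add0r chpair_step. Qed.

Fact ch_unit_ge0 : 0 <= ch_unit.
Proof.
apply/asboolP; exists (0, mv0), (0, mv1); split=> //.
by rewrite /chlex /= mvle1.
Qed.

Lemma ch_unitMn (n : nat) : ch_unit *+ n = chpair n%:Z mv0.
Proof.
elim: n => [|n IH]; first by rewrite mulr0n.
rewrite mulrS IH chpair_unit; apply: chc_inj => k.
rewrite chc_addr mvmul0 mvadd0 !chc_pair /chco /=.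
by rewrite intS ltrBlDr subr_eq.
Qed.

Fact ch_unit_strong x : exists n : nat, lgabs x <= ch_unit *+ n.
Proof.
case: (repr x) (chpair_repr x) => m a /= ->.
exists (`|m| + 1 + (`|m| + 1))%N; apply: lgabs_le ch_unit_ge0 _ _.
  rewrite ch_unitMn; apply/asboolP; exists (m, a), ((`|m| + 1)%N%:Z, mv0); split=> //.
  by apply/orP; left => /=; lia.
rewrite ch_unitMn chpairN; apply/asboolP.
exists (- m - 1, ¬ a), ((`|m| + 1)%N%:Z, mv0); split=> //.
by apply/orP; left => /=; lia.
Qed.

HB.instance Definition _ := hasStrongUnit.Build (Ch C) ch_unit_ge0 ch_unit_strong.
HB.instance Definition _ := isLuTotal.Build (Ch C) chle_total.

End ChGroup.

Section ChMap.
Variables (C D : mvChainType) (f : mvHom C D).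

(** [Ch f] maps [(m, a)] to [(m, f a)], see [Ch_mapE]. *)
Definition Ch_map (x : Ch C) : Ch D := chpair (repr x).1 (f (repr x).2).

Lemma chco_map m (a : C) k : chco (m, f a) k = f (chco (m, a) k).
Proof.
by rewrite /chco /=; case: ifP => _; rewrite ?mvhom1 //; case: ifP; rewrite ?mvhom0.
Qed.

Lemma chc_map x k : chc (Ch_map x) k = f (chc x k).
Proof. by rewrite chc_pair chco_map -surjective_pairing. Qed.

Lemma Ch_mapE m a : Ch_map (chpair m a) = chpair m (f a).
Proof. by apply: chc_inj => k; rewrite chc_map !chc_pair chco_map. Qed.
End ChMap.

Section Chang.
Variable G : luChainType.

(** Chang's map [Ch(Γ(G, u)) -> G] sends [(m, a)] to [m u + a], see [changE]. *)
Definition chang_val (p : int * Gamma G) : G := lunit *~ p.1 + gval p.2.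
Definition chang (x : Ch (Gamma G)) : G := chang_val (repr x).

Lemma changE m (a : Gamma G) : chang (chpair m a) = lunit *~ m + gval a.
Proof.
have : chrel (repr (chpair m a)) (m, a).
  by apply/chrelP => k; rewrite -[RHS]chc_pi.
rewrite /chang => /asboolP h; rewrite -[RHS]/(chang_val (m, a)).
elim: h => [p q [k [-> ->]]|//|p q _ ->//|p q r _ -> _ ->//].
by rewrite /chang_val /fst /snd gval1 gval0 addr0 mulrzDr mulr1z.
Qed.
End Chang.

Definition prodCh (A : mvType) : Type := forall P : mvSp A, Ch (mvfiber P).

Section ProdCh.
Variable A : mvType.
Implicit Types s t r : prodCh A.

HB.instance Definition _ := gen_eqMixin (prodCh A).
HB.instance Definition _ := gen_choiceMixin (prodCh A).

Lemma prodCh_ext s t : (forall P, s P = t P) -> s = t.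
Proof. exact: functional_extensionality_dep. Qed.

Definition prod0 : prodCh A := fun P => 0.
Definition prodN s : prodCh A := fun P => - s P.
Definition prodD s t : prodCh A := fun P => s P + t P.
Definition prod_le s t : bool := `[< forall P, s P <= t P >].
Definition prod_join s t : prodCh A := fun P => s P ∨ t P.
Definition prod_meet s t : prodCh A := fun P => s P ∧ t P.

Fact prodDA : associative prodD.
Proof. by move=> s t r; apply: prodCh_ext => P; apply: addrA. Qed.
Fact prodDC : commutative prodD.
Proof. by move=> s t; apply: prodCh_ext => P; apply: addrC. Qed.
Fact prod0D : left_id prod0 prodD.
Proof. by move=> s; apply: prodCh_ext => P; apply: add0r. Qed.
Fact prodND : left_inverse prod0 prodN prodD.
Proof. by move=> s; apply: prodCh_ext => P; apply: addNr. Qed.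

HB.instance Definition _ :=
  GRing.isZmodule.Build (prodCh A) prodDA prodDC prod0D prodND.

Fact prod_le_refl : reflexive prod_le.
Proof. by move=> s; apply/asboolP => P. Qed.
Fact prod_le_anti : antisymmetric prod_le.
Proof.
move=> s t /andP[/asboolP st /asboolP ts]; apply: prodCh_ext => P.
by apply: le_anti; rewrite st ts.
Qed.
Fact prod_le_trans : transitive prod_le.
Proof.
move=> t s r /asboolP st /asboolP tr; apply/asboolP => P.
exact: le_trans (st P) (tr P).
Qed.

HB.instance Definition _ := Order.Le_isPOrder.Build ring_display (prodCh A)
  prod_le_refl prod_le_anti prod_le_trans.

Lemma prod_leP s t : reflect (forall P, s P <= t P) (s <= t).
Proof. exact: asboolP. Qed.

Fact prod_leUx s t r : (prod_join s t <= r) = (s <= r) && (t <= r).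
Proof.
apply/prod_leP/andP => [h|[/prod_leP h1 /prod_leP h2] P].
  by split; apply/prod_leP => P; have := h P; rewrite lg_leUx => /andP[].
by rewrite /prod_join lg_leUx h1 h2.
Qed.
Fact prod_lexI s t r : (r <= prod_meet s t) = (r <= s) && (r <= t).
Proof.
apply/prod_leP/andP => [h|[/prod_leP h1 /prod_leP h2] P].
  by split; apply/prod_leP => P; have := h P; rewrite lg_lexI => /andP[].
by rewrite /prod_meet lg_lexI h1 h2.
Qed.
Fact prod_le_add2l r s t : s <= t -> r + s <= r + t.
Proof. by move=> /prod_leP st; apply/prod_leP => P; apply: lg_le_add2l (st P). Qed.

HB.instance Definition _ := isLGroup.Build (prodCh A)
  prod_leUx prod_lexI prod_le_add2l.

Lemma prodCh0E P : (0 : prodCh A) P = 0. Proof. by []. Qed.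
Lemma prodChDE s t P : (s + t) P = s P + t P. Proof. by []. Qed.
Lemma prodChNE s P : (- s) P = - s P. Proof. by []. Qed.
Lemma prodChUE s t P : (s ∨ t) P = s P ∨ t P. Proof. by []. Qed.
Lemma prodChIE s t P : (s ∧ t) P = s P ∧ t P. Proof. by []. Qed.
Lemma prodChMnE s n P : (s *+ n) P = s P *+ n.
Proof. by elim: n => [|n IH] //; rewrite !mulrS prodChDE IH. Qed.

(** The section [P |-> (0, [a]_P)]; [Acirc] is [A°] and [star] below is [A^*]. *)
Definition iota_v (a : A) : prodCh A := fun P => chpair 0 (mvcls P a).

Definition Acirc : set (prodCh A) := range iota_v.
Definition Astar : set (prodCh A) := gen_subgroup Acirc.

Definition ustar : prodCh A := iota_v mv1.

Lemma ustarE P : ustar P = ch_unit (mvfiber P).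
Proof. by rewrite /ustar /iota_v mvhom1. Qed.

Lemma ustar_ge0 : 0 <= ustar.
Proof. by apply/prod_leP => P; rewrite ustarE; apply: ch_unit_ge0. Qed.

Lemma Acirc_sub_Astar a : Astar (iota_v a).
Proof. by apply: sub_gen_smallest; exists a. Qed.

Lemma chc_iota a P k : chc (iota_v a P) k = chco (0, mvcls P a) k.
Proof. exact: chc_pair. Qed.

(** Elements of [Astar] are those whose coordinates come from elements of [A],
    uniformly in [P], and are eventually trivial. *)
Definition star_good s : Prop := exists N : int,
  [/\ forall k, exists a, forall P, chc (s P) k = mvcls P a,
      forall (k : int) P, k < - N -> chc (s P) k = mv1
    & forall (k : int) P, N <= k -> chc (s P) k = mv0].

Lemma star_good_iota a s : star_good s -> star_good (s + iota_v a).
Proof.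
move=> [N [h1 h2 h3]].
have E k P : chc ((s + iota_v a) P) k
    = chc (s P) k ⊕ (chc (s P) (k - 1) ⊙ mvcls P a).
  by rewrite chc_addr subr0.
exists (N + 1); split=> [k|k P hk|k P hk].
- have [b hb] := h1 k; have [c hc] := h1 (k - 1).
  by exists (b ⊕ (c ⊙ a)) => P; rewrite E hb hc mvhomD mvhomM.
- by rewrite E h2 ?mv1add //; lia.
- by rewrite E !h3 ?mv0mul ?mvadd0 //; lia.
Qed.

Lemma star_good_opp s : star_good s -> star_good (- s).
Proof.
move=> [N [h1 h2 h3]].
have E k P : chc ((- s) P) k = ¬ chc (s P) (- k - 1) by rewrite chc_opp.
exists (N + 1); split=> [k|k P hk|k P hk].
- by have [b hb] := h1 (- k - 1); exists (¬ b) => P; rewrite E hb mvhomN.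
- by rewrite E h3 //; lia.
- by rewrite E h2 ?mvneg1 //; lia.
Qed.

Lemma star_good0 : star_good 0.
Proof.
have E k P : chc ((0 : prodCh A) P) k = chco (0, mv0 : mvfiber P) k.
  exact: chc_pair.
exists 0; split=> [k|k P hk|k P hk].
- exists (if k < 0 then mv1 else mv0) => P.
  by rewrite (fun_if (mvcls P)) mvhom1 mvhom0 E /chco /= if_same.
- by rewrite E chco_lt //=; lia.
- by rewrite E /chco /= if_same; case: ifP => //; lia.
Qed.

Lemma Astar_good s : Astar s -> star_good s.
Proof.
pose T := [set t | forall s, star_good s -> star_good (s + t) /\ star_good (s - t)].
have goodB a t : star_good t -> star_good (t - iota_v a).
  move=> ht; rewrite -[t - _]opprK; apply: star_good_opp.
  by rewrite opprB addrC; apply/star_good_iota/star_good_opp.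
suff TA : Astar `<=` T.
  by move=> /TA /(_ 0 star_good0)[]; rewrite add0r.
apply: smallest_sub => [|_ [a _ <-] t ht].
  split=> [t ht|x y Tx Ty t ht]; first by rewrite subr0 addr0.
  have [h1 h2] := Tx t ht; have [h3 h4] := Ty t ht.
  split; first by rewrite addrA; case: (Ty _ h1).
  by rewrite opprB addrA; case: (Tx _ h3).
by split; [apply: star_good_iota | apply: goodB].
Qed.

End ProdCh.

Arguments ustar A : clear implicits.

Lemma chc_mono (C : mvChainType) (x : Ch C) (i j : int) :
  i < j -> chc x i = mv1 \/ chc x j = mv0.
Proof.
move=> ij; case: (repr x) (chpair_repr x) => m a /= ->; rewrite !chc_pair.
have [h|h] := ltP i m; first by left; rewrite chco_lt.
by right; rewrite chco_gt //=; lia.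
Qed.

Lemma ch_sum (C : mvChainType) (x : Ch C) (n : nat) :
  (forall k : int, k < 0 -> chc x k = mv1) -> (forall k : int, n%:Z <= k -> chc x k = mv0) ->
  x = \sum_(i < n) chpair 0 (chc x i%:Z).
Proof.
move=> h1 h2.
suff H m k : chc (\sum_(i < m) chpair 0 (chc x i%:Z)) k
    = if k < m%:Z then chc x k else mv0.
  by apply: chc_inj => k; rewrite H; case: ltP => // /h2.
elim: m k => [|m IH] k.
  rewrite big_ord0 chc_pair /chco /= if_same.
  by case: ifP => // /h1.
rewrite big_ord_recr /= chc_addr subr0 !IH.
have [h|[h|h]] : k < m%:Z \/ k = m%:Z \/ m%:Z < k by lia.
- rewrite h (_ : (k < m.+1%:Z) = true); last by lia.
  have [->|->] := chc_mono x h; first by rewrite mv1add.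
  by rewrite mvmul0 mvadd0.
- rewrite h ltxx (_ : (m%:Z < m.+1%:Z) = true); last by lia.
  rewrite (_ : (m%:Z - 1 < m%:Z) = true); last by lia.
  rewrite mv0add; have [||->] := chc_mono x (i := m%:Z - 1) (j := m%:Z).
  + lia.
  + by move=> ->; rewrite mv1mul.
  + by rewrite mvmul0.
- rewrite (_ : (k < m%:Z) = false); last by lia.
  rewrite (_ : (k - 1 < m%:Z) = false); last by lia.
  rewrite (_ : (k < m.+1%:Z) = false); last by lia.
  by rewrite mv0mul mvadd0.
Qed.

Section Star.
Variable A : mvType.
Implicit Types s t : prodCh A.

Lemma prodCh_sumE (n : nat) (F : nat -> prodCh A) P :
  (\sum_(i < n) F i) P = \sum_(i < n) F i P.
Proof.
elim: n => [|n IH]; first by rewrite !big_ord0.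
by rewrite !big_ord_recr /= prodChDE IH.
Qed.

Lemma Astar_sub : is_subgroup (@Astar A). Proof. exact: gen_subgroupP. Qed.

Lemma Astar_sum (n : nat) (F : nat -> prodCh A) :
  (forall i, Astar (F i)) -> Astar (\sum_(i < n) F i).
Proof.
move=> hF; elim: n => [|n IH]; first by rewrite big_ord0; case: Astar_sub.
by rewrite big_ord_recr /=; apply: is_subgroupD Astar_sub _ _.
Qed.

Lemma good_Astar s : star_good s -> Astar s.
Proof.
move=> [N [h1 h2 h3]]; have [f hf] := choice h1.
pose M := `|N|%N.
have uM P k : chc ((s + ustar A *+ M) P) k = chc (s P) (k - M%:Z).
  rewrite prodChDE prodChMnE ustarE ch_unitMn chc_addr.
  by rewrite mvmul0 mvadd0.
have -> : s = (\sum_(i < (M + M)%N) iota_v (f (i%:Z - M%:Z))) - ustar A *+ M.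
  apply/eqP; rewrite eq_sym subr_eq; apply/eqP/prodCh_ext => P.
  rewrite (prodCh_sumE _ (fun i => iota_v (f (i%:Z - M%:Z)))) [RHS](@ch_sum _ _ (M + M)%N).
  - by apply: eq_bigr => i _; rewrite uM hf.
  - by move=> k hk; rewrite uM h2 //; lia.
  - by move=> k hk; rewrite uM h3 //; lia.
have Au n : Astar (ustar A *+ n).
  elim: n => [|n IH]; first by rewrite mulr0n; case: Astar_sub.
  rewrite mulrS; apply: is_subgroupD Astar_sub _ IH; exact: Acirc_sub_Astar.
case: Astar_sub => _; apply=> //.
by apply: (@Astar_sum _ (fun i => iota_v (f (i%:Z - M%:Z)))) => i;
   apply: Acirc_sub_Astar.
Qed.

Lemma chc_join (C : mvChainType) (x y : Ch C) k :
  chc (x ∨ y) k = mvjoin (chc x k) (chc y k).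
Proof.
case/orP: (lu_le_total x y) => xy.
  by rewrite lg_join_r // mvjoin_r //; move/chleP: xy; apply.
by rewrite lg_join_l // mvjoin_l //; move/chleP: xy; apply.
Qed.

Lemma AstarU s t : Astar s -> Astar t -> Astar (s ∨ t).
Proof.
move=> /Astar_good[N [h1 h2 h3]] /Astar_good[M [g1 g2 g3]].
apply: good_Astar.
have E k P : chc ((s ∨ t) P) k = mvjoin (chc (s P) k) (chc (t P) k).
  exact: chc_join.
exists (`|N| + `|M|); split=> [k|k P hk|k P hk].
- have [a ha] := h1 k; have [b hb] := g1 k; exists (mvjoin a b) => P.
  by rewrite E ha hb /mvjoin mvhomD mvhomM mvhomN.
- by rewrite E h2 ?g2 ?mvjoin_l //; lia.
- by rewrite E h3 ?g3 ?mvjoin_l //; lia.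
Qed.

Lemma AstarI s t : Astar s -> Astar t -> Astar (s ∧ t).
Proof.
move=> hs ht; rewrite -[_ ∧ _]opprK lg_meetN.
by apply: (is_subgroupN Astar_sub); apply: AstarU; apply: (is_subgroupN Astar_sub).
Qed.

Lemma Astar_bounded s : Astar s -> exists n : nat, s <= ustar A *+ n.
Proof.
move=> /Astar_good[N [_ _ h]]; exists `|N|%N; apply/prod_leP => P.
rewrite prodChMnE ustarE ch_unitMn; apply/chleP => k; rewrite chc_pair.
have [hk|hk] := ltP k `|N|%N%:Z; first by rewrite chco_lt.
by rewrite h ?mvle0 //; lia.
Qed.

Definition in_Astar : {pred prodCh A} := fun s => `[< Astar s >].

Fact Astar_zmod_closed : zmod_closed in_Astar.
Proof.
split=> [|s t /asboolP hs /asboolP ht]; apply/asboolP; first by case: Astar_sub.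
by case: Astar_sub => _; apply.
Qed.
HB.instance Definition _ :=
  GRing.isZmodClosed.Build (prodCh A) in_Astar Astar_zmod_closed.

Record star := MkStar { star_val : prodCh A; star_valP : star_val \in in_Astar }.

HB.instance Definition _ := [isSub for star_val].
HB.instance Definition _ := [Choice of star by <:].
HB.instance Definition _ := [SubChoice_isSubZmodule of star by <:].
HB.instance Definition _ := [SubChoice_isSubPOrder of star by <: with ring_display].

Implicit Types x y z : star.

Lemma star_in x : Astar (star_val x). Proof. exact/asboolP/(star_valP x). Qed.

Fact starU_subproof x y : star_val x ∨ star_val y \in in_Astar.
Proof. by apply/asboolP; exact: AstarU (star_in x) (star_in y). Qed.
Fact starI_subproof x y : star_val x ∧ star_val y \in in_Astar.
Proof. by apply/asboolP; exact: AstarI (star_in x) (star_in y). Qed.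
Definition star_join x y : star := MkStar (starU_subproof x y).
Definition star_meet x y : star := MkStar (starI_subproof x y).

Lemma star_leE x y : (x <= y) = (star_val x <= star_val y).
Proof. by []. Qed.

Fact star_leUx x y z : (star_join x y <= z) = (x <= z) && (y <= z).
Proof. by rewrite !star_leE lg_leUx. Qed.
Fact star_lexI x y z : (z <= star_meet x y) = (z <= x) && (z <= y).
Proof. by rewrite !star_leE lg_lexI. Qed.
Fact star_le_add2l z x y : x <= y -> z + x <= z + y.
Proof. by rewrite !star_leE; apply: (@lg_le_add2l (prodCh A)). Qed.

HB.instance Definition _ := isLGroup.Build star
  star_leUx star_lexI star_le_add2l.

Lemma star_iota_subproof (a : A) : iota_v a \in in_Astar.
Proof. apply/asboolP; exact: Acirc_sub_Astar. Qed.

Definition star_iota (a : A) : star := MkStar (star_iota_subproof a).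

Lemma star_valD x y : star_val (x + y) = star_val x + star_val y.
Proof. by []. Qed.
Lemma star_valN x : star_val (- x) = - star_val x.
Proof. by []. Qed.
Lemma star_valU x y : star_val (x ∨ y) = star_val x ∨ star_val y.
Proof. by []. Qed.
Lemma star_valI x y : star_val (x ∧ y) = star_val x ∧ star_val y.
Proof. by []. Qed.
Lemma star_val0 : star_val 0 = 0.
Proof. by []. Qed.
Lemma star_valMn x n : star_val (x *+ n) = star_val x *+ n.
Proof. by elim: n => [|n IH] //; rewrite !mulrS star_valD IH. Qed.

Fact star_unit_ge0 : 0 <= star_iota mv1.
Proof. by rewrite star_leE star_val0; apply: ustar_ge0. Qed.
Fact star_unit_strong x : exists n : nat, lgabs x <= star_iota mv1 *+ n.
Proof.
have [m hm] := Astar_bounded (star_in x).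
have [n hn] := Astar_bounded (is_subgroupN Astar_sub (star_in x)).
exists (m + n)%N.
apply: lgabs_le star_unit_ge0 _ _; rewrite star_leE star_valMn //.
Qed.

HB.instance Definition _ := hasStrongUnit.Build star
  star_unit_ge0 star_unit_strong.

Lemma star_val_unit : star_val (lunit : star) = iota_v (mv1 : A).
Proof. by []. Qed.

Lemma star_val_inj : injective star_val. Proof. exact: val_inj. Qed.

Lemma iotaN_subproof a : iota_v (¬ a : A) = ustar A - iota_v a.
Proof.
apply: prodCh_ext => P.
rewrite prodChDE prodChNE /ustar /iota_v mvhomN mvhom1.
by rewrite chpairN chpairD mv1add eqxx mv1mul; congr chpair; lia.
Qed.

Lemma iotaD_subproof a b :
  iota_v (a ⊕ b : A) = ustar A ∧ (iota_v a + iota_v b).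
Proof.
apply: prodCh_ext => P.
rewrite prodChIE prodChDE ustarE /iota_v mvhomD chpairD.
case: eqP => [ab|_].
  rewrite lg_meet_l; first by rewrite ab.
  apply/asboolP; exists (0, mv1), (0 + 0 + 1, mvcls P a ⊙ mvcls P b); split=> //.
rewrite lg_meet_r // ; apply/asboolP.
by exists (0 + 0, mvcls P a ⊕ mvcls P b), (0, mv1); split=> //; rewrite /chlex /= mvle1.
Qed.

Fact iota_ge0 a : 0 <= star_iota a.
Proof.
rewrite star_leE; apply/prod_leP => P; apply/asboolP.
by exists (0, mv0), (0, mvcls P a); split=> //; rewrite /chlex /= mvle0.
Qed.

Fact iota_le1 a : star_iota a <= lunit.
Proof.
rewrite star_leE star_val_unit; apply/prod_leP => P; apply/asboolP.
exists (0, mvcls P a), (0, mv1); split=> //; last by rewrite /chlex /= mvle1.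
by rewrite /iota_v mvhom1.
Qed.

Fact iota_subproof a : 0 <= star_iota a <= lunit.
Proof. by rewrite iota_ge0 iota_le1. Qed.

Definition iota_fun (a : A) : Gamma star := MkGamma (iota_subproof a).

Fact iota_fun0 : iota_fun mv0 = mv0.
Proof.
apply: gval_inj; apply: star_val_inj; apply: prodCh_ext => P.
by rewrite /= /iota_v mvhom0.
Qed.
Fact iota_funN : {morph iota_fun : a / ¬ a}.
Proof. by move=> a; apply/gval_inj/star_val_inj/iotaN_subproof. Qed.
Fact iota_funD : {morph iota_fun : a b / a ⊕ b}.
Proof. by move=> a b; apply/gval_inj/star_val_inj/iotaD_subproof. Qed.

(** The map [A -> Γ(A^*, u)] sending [a] to [P |-> (0, [a]_P)] *)
Definition iota_hom : mvHom A (Gamma star) :=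
  MVHom iota_fun0 iota_funN iota_funD.

End Star.

(** The map on products induced by a morphism [h : A -> B] *)
Definition induced (A B : mvType) (h : mvHom A B) (s : prodCh A) : prodCh B :=
  fun P => Ch_map (mvrestr h P) (s (mvpre h P)).

(** The composite of the fiberwise identifications and Chang's maps
    [Ch(Γ(G,u) / (P ∩ [0,u])) -> Ch(Γ(G/P, [u]_P)) -> G/P],
    from the product for [Γ(G,u)] to the product of the quotients of [G]. *)
Definition upsilon_fib (G : luType) (s : prodCh (Gamma G)) (P : lSp G) : lfiber P :=
  chang (Ch_map (gident P) (s (ltrace P))).

Record category := Category {
  obj :> Type;
  hom : obj -> obj -> Type;
  idm : forall X, hom X X;
  comp : forall X Y Z, hom Y Z -> hom X Y -> hom X Z;
  comp1m : forall X Y (f : hom X Y), comp (idm Y) f = f;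
  compm1 : forall X Y (f : hom X Y), comp f (idm X) = f;
  compA : forall X Y Z T (h : hom Z T) (g : hom Y Z) (f : hom X Y),
    comp h (comp g f) = comp (comp h g) f
}.
Arguments idm {c} X.
Arguments comp {c X Y Z} g f.

Definition is_iso (C : category) (X Y : C) (f : hom X Y) : Prop :=
  exists g : hom Y X, comp g f = idm X /\ comp f g = idm Y.

Definition is_functor (C D : category) (F0 : C -> D)
    (F1 : forall X Y, hom X Y -> hom (F0 X) (F0 Y)) : Prop :=
  (forall X, F1 X X (idm X) = idm (F0 X)) /\
  (forall X Y Z (g : hom Y Z) (f : hom X Y),
     F1 X Z (comp g f) = comp (F1 Y Z g) (F1 X Y f)).

Record functor (C D : category) := Functor {
  fobj :> C -> D;
  fmap : forall X Y, hom X Y -> hom (fobj X) (fobj Y);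
  fmapP : is_functor fmap
}.
Arguments fmap {C D} f {X Y}.

Fact idF_subproof (C : category) : is_functor (fun (X Y : C) (f : hom X Y) => f).
Proof. by []. Qed.
Definition idF (C : category) : functor C C := Functor (idF_subproof C).

Fact compF_subproof (C D E : category) (G : functor D E) (F : functor C D) :
  is_functor (fun (X Y : C) (f : hom X Y) => fmap G (fmap F f)).
Proof.
have [F1 FM] := fmapP F; have [G1 GM] := fmapP G.
by split=> [X|X Y Z g f]; rewrite ?F1 ?G1 ?FM ?GM.
Qed.
Definition compF (C D E : category) (G : functor D E) (F : functor C D) :
  functor C E := Functor (compF_subproof G F).

Definition is_natural (C D : category) (F G : functor C D)
    (eta : forall X, hom (F X) (G X)) : Prop :=
  forall X Y (f : hom X Y), comp (eta Y) (fmap F f) = comp (fmap G f) (eta X).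

Fact mvcomp1m (A B : mvType) (f : mvHom A B) : mvcomp (mvid B) f = f.
Proof. exact: mvHom_eq. Qed.
Fact mvcompm1 (A B : mvType) (f : mvHom A B) : mvcomp f (mvid A) = f.
Proof. exact: mvHom_eq. Qed.
Fact mvcompA (A B C D : mvType) (h : mvHom C D) (g : mvHom B C) (f : mvHom A B) :
  mvcomp h (mvcomp g f) = mvcomp (mvcomp h g) f.
Proof. exact: mvHom_eq. Qed.

Definition MV_cat : category := Category mvcomp1m mvcompm1 mvcompA.

Fact lucomp1m (G H : luType) (f : luHom G H) : lucomp (luid H) f = f.
Proof. exact: luHom_eq. Qed.
Fact lucompm1 (G H : luType) (f : luHom G H) : lucomp f (luid G) = f.
Proof. exact: luHom_eq. Qed.
Fact lucompA (G H K L : luType) (h : luHom K L) (g : luHom H K) (f : luHom G H) :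
  lucomp h (lucomp g f) = lucomp (lucomp h g) f.
Proof. exact: luHom_eq. Qed.

Definition Gu_cat : category := Category lucomp1m lucompm1 lucompA.

Fact Gamma_functor_subproof :
  @is_functor Gu_cat MV_cat (fun G : luType => Gamma G : mvType)
    (fun (G H : luType) (f : luHom G H) => Gamma_map f).
Proof. by split=> *; apply: mvHom_eq => x; apply: gval_inj. Qed.

Definition Gamma_functor : functor Gu_cat MV_cat := Functor Gamma_functor_subproof.

(* Main.v *)
Require Import Defs.
From HB Require Import structures.
From mathcomp Require Import all_boot all_order all_algebra.
From mathcomp Require Import zify.
From mathcomp Require Import boolp classical_sets.

Set Implicit Arguments.
Unset Strict Implicit.
Unset Printing Implicit Defensive.

Import Order.TTheory GRing.Theory Num.Theory.

Local Open Scope ring_scope.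

(** Every construction is controlled by the generators [iota_v a] of [A^*].
    Two morphisms of [l_u]-groups out of [A^*] that agree on them are equal
    ([star_hom_eq]), so that identities between such morphisms need only be
    checked there, where [h^*] sends [iota_v a] to [iota_v (h a)]
    ([induced_iota]) and [υ] sends [iota_v a] to [a] ([upsilon_fun_iota]).
    Functoriality and the naturality of [υ] follow at once; the naturality of
    [a |-> iota_v a] is the formula for [h^*] itself.

    That [h^*] is a morphism is fiberwise: [Ch f] is additive and monotone,
    hence preserves the lattice operations because its source is a chain
    ([Ch_hom]); the same applies to Chang's map ([chang_hom]).

    That [A -> Γ(A^*, u)] is bijective has two halves. Injectivity is Chang's
    subdirect representation: a nonzero element avoids some prime ideal
    ([mvprime_avoid]), by Zorn's lemma and prelinearity. Surjectivity holds
    because the coordinates of an element of [A^*] come from elements of [A],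
    uniformly in the prime ideal, and an element between [0] and [u] has only
    one nontrivial coordinate ([Acirc_unit_interval]).

    For [υ], the prime ideals [Q] of [Γ(G, u)] are extended to prime [l]-ideals
    of [G], namely the set of [x] such that [|x| ∧ u] lies in [Q] ([lext]).
    Thus [G] embeds into the product of its totally ordered quotients
    ([lcls_inj]), which determines [υ] and makes it a morphism; it exists since
    the fiberwise map sends the generators into the image of [G]
    ([upsilon_factor]). It is surjective because the unit interval generates
    [G] ([gamma_generates]). It is injective because the truncation of an
    element [s] of its kernel is some [iota_v a], with [a] the image of that
    truncation, that is [0]; and only [0] has truncation [0]
    ([ltrunc_eq0]). *)

(** * Lattice structure of MV-algebras *)

Section MVLattice.
Local Open Scope mv_scope.
Variable A : mvType.
Implicit Types x y z : A.

Lemma mvjoin_lub x y z : x ≤ z -> y ≤ z -> mvjoin x y ≤ z.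
Proof.
move=> xz yz; rewrite -(mvle_sub yz).
by apply: mvle_add => //; apply: mvle_mul.
Qed.

Lemma mvle_joinr x y : y ≤ mvjoin x y.
Proof. exact: mvle_addl. Qed.

Lemma mvle_joinl x y : x ≤ mvjoin x y.
Proof. by rewrite mvjoinC mvle_joinr. Qed.

Lemma mvmeet_lel x y : mvmeet x y ≤ x.
Proof. by rewrite /mvmeet -mvleN mvnegK mvle_joinl. Qed.

Lemma mvmeet_ler x y : mvmeet x y ≤ y.
Proof. by rewrite /mvmeet -mvleN mvnegK mvle_joinr. Qed.

Lemma mvmeet_glb x y z : z ≤ x -> z ≤ y -> z ≤ mvmeet x y.
Proof.
by move=> zx zy; rewrite -mvleN /mvmeet mvnegK mvjoin_lub ?mvleN.
Qed.

Lemma mvmeetC x y : mvmeet x y = mvmeet y x.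
Proof. by rewrite /mvmeet mvjoinC. Qed.

(** Translation by [z] is a right adjoint by [mvres], hence preserves meets. *)
Lemma mvmeet_addr x y z : mvmeet (x ⊕ z) (y ⊕ z) ≤ mvmeet x y ⊕ z.
Proof.
rewrite [X in _ ≤ X]mvaddC -mvres; apply: mvmeet_glb; rewrite mvres.
  by rewrite [z ⊕ x]mvaddC mvmeet_lel.
by rewrite [z ⊕ y]mvaddC mvmeet_ler.
Qed.

(** Meet with [z] is subadditive. *)
Lemma mvmeet_subadd x y z :
  mvmeet z (x ⊕ y) ≤ mvmeet z x ⊕ mvmeet z y.
Proof.
apply: mvle_trans (mvmeet_addr _ _ _); apply: mvmeet_glb.
  by apply: mvle_trans (mvmeet_lel _ _) (mvle_addr _ _).
rewrite [x ⊕ mvmeet _ _]mvaddC; apply: mvle_trans (mvmeet_addr _ _ _).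
apply: mvmeet_glb; last by rewrite mvaddC mvmeet_ler.
by apply: mvle_trans (mvmeet_lel _ _) (mvle_addr _ _).
Qed.

(** Iterated sum [x ⊕ ... ⊕ x] *)
Definition mvnmul x (n : nat) : A := iter n (mvadd x) mv0.

Lemma mvnmulD x m n : mvnmul x (m + n) = mvnmul x m ⊕ mvnmul x n.
Proof.
by elim: m => [|m IH]; rewrite ?mv0add // /mvnmul addSn /= -!/(mvnmul _ _) IH mvaddA.
Qed.

Lemma mvmeet_nmul0 x y n : mvmeet x y = mv0 -> mvmeet x (mvnmul y n) = mv0.
Proof.
move=> xy; elim: n => [|n IH]; first by apply: mvle_eq0; apply: mvmeet_ler.
by apply: mvle_eq0; apply: mvle_trans (mvmeet_subadd _ _ _) _; rewrite xy IH mvadd0.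
Qed.

Lemma mvmeet_nmul00 x y m n :
  mvmeet x y = mv0 -> mvmeet (mvnmul x m) (mvnmul y n) = mv0.
Proof.
by move=> xy; rewrite mvmeetC; apply: mvmeet_nmul0; rewrite mvmeetC; apply: mvmeet_nmul0.
Qed.

(** Prelinearity: with [m] the meet of [x] and [y], the meet [d] of the two
    differences satisfies [d ⊕ m = m] and can be cancelled. *)
Lemma mvmeet_sub0 x y : mvmeet (x ⊙ ¬ y) (y ⊙ ¬ x) = mv0.
Proof.
set m := mvmeet x y; set d := mvmeet _ _.
have subE (a b : A) : a ⊙ ¬ b ≤ a ⊙ ¬ mvmeet a b.
  by apply: mvle_mul => //; rewrite mvleN mvmeet_ler.
have subm (a b : A) : (a ⊙ ¬ b) ⊕ mvmeet a b ≤ a.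
  by rewrite -{3}(mvle_sub (mvmeet_lel a b)); apply: mvle_add.
apply: (@mvadd_cancel _ m) => //.
  apply: mvle_trans (mvmeet_lel _ _) _; apply: mvle_trans (subE _ _) _.
  by rewrite -[X in _ ≤ X]mv1mul; apply: mvle_mul.
rewrite mv0add; apply: mvle_anti; last exact: mvle_addl.
apply: mvmeet_glb.
  by apply: mvle_trans (subm x y); apply/mvle_add2r/mvmeet_lel.
by apply: mvle_trans (subm y x); rewrite /m mvmeetC; apply/mvle_add2r/mvmeet_ler.
Qed.

End MVLattice.

(** * Prime ideals of MV-algebras *)

Section MVPrime.
Local Open Scope mv_scope.
Local Open Scope classical_set_scope.
Variable A : mvType.
Implicit Types (x y z : A) (M : set A).

(** [M] is empty or an ideal, and does not contain [a]. Allowing the empty set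
    gives the empty chain an upper bound in Zorn's lemma. *)
Definition mvavoid (a : A) M : Prop :=
  [/\ ~ M a, forall x y, x ≤ y -> M y -> M x & forall x y, M x -> M y -> M (x ⊕ y)].

Lemma mvavoid_bigcup a (F : set (set A)) :
  F `<=` mvavoid a -> total_on F subset -> mvavoid a (\bigcup_(X in F) X).
Proof.
move=> Fa Ftot; split=> [[X /Fa[]//]|x y xy [X FX Xy]|x y [X FX Xx] [Y FY Yy]].
  by exists X => //; have [_ h _] := Fa _ FX; apply: h xy Xy.
have [XY|YX] := Ftot _ _ FX FY.
  by exists Y => //; have [_ _] := Fa _ FY; apply=> //; apply: XY.
by exists X => //; have [_ _] := Fa _ FX; apply=> //; apply: YX.
Qed.

Lemma mvtotal_quot (P : mvIdeal A) :
  (forall x y, P (x ⊙ ¬ y) \/ P (y ⊙ ¬ x)) -> total (@mvle (mvquot P)).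
Proof.
move=> h p q; have [x ->] := mvclass_surj p; have [y ->] := mvclass_surj q.
by apply/orP; have [/mvclass_le|/mvclass_le] := h x y; [left | right].
Qed.

(** The ideal generated by [M] and [z] when [M] is an ideal; the empty set when
    [M] is empty *)
Definition mvadjoin M z : set A :=
  [set t | exists p n, M p /\ t ≤ p ⊕ mvnmul z n].

Lemma mvadjoin_avoid a M z : mvavoid a M -> ~ mvadjoin M z a ->
  mvavoid a (mvadjoin M z).
Proof.
move=> [Ma Mle MD] za; split=> // [x y xy [p [n [Mp yp]]]|].
  by exists p, n; split=> //; apply: mvle_trans yp.
move=> x y [p [m [Mp xp]]] [q [n [Mq yq]]]; exists (p ⊕ q), (m + n)%N.
split; first exact: MD.
rewrite mvnmulD -mvaddA (mvaddCA q) mvaddA; exact: mvle_add.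
Qed.

Lemma mvmaximal_adjoin a M z : mvavoid a M ->
    (forall N, M `<` N -> ~ mvavoid a N) -> M mv0 -> ~ M z -> mvadjoin M z a.
Proof.
move=> Mav Mmax M0 Mz; apply: contrapT => za.
apply: (Mmax (mvadjoin M z)); last exact: mvadjoin_avoid.
split=> [x Mx|adjM]; first by exists x, 0%N; rewrite mvadd0.
apply/Mz/adjM; exists mv0, 1%N; split=> //.
by rewrite mv0add /mvnmul /= mvadd0.
Qed.

(** Chang's separation theorem: an ideal maximal among those that avoid [a] is
    prime, by prelinearity. *)
Lemma mvprime_avoid (a : A) : a <> mv0 -> exists P : mvSp A, ~ P a.
Proof.
move=> a0; have [M [Mav Mmax]] := Zorn_bigcup (@mvavoid_bigcup a).
have [Ma Mle MD] := Mav.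
have M0 : M mv0.
  (* Otherwise [M] is empty, hence smaller than the zero ideal. *)
  apply: contrapT => M0; apply: (Mmax [set mv0]).
    split=> [x Mx|]; last by move=> /(_ mv0 erefl).
    by case: M0; apply: Mle Mx.
  split=> [/a0//|x y xy /= y0|x y /= -> ->]; last exact: mvadd0.
  by apply: mvle_eq0; rewrite -y0.
pose I := MVIdeal M0 Mle MD.
have Itot : total (@mvle (mvquot I)).
  apply: mvtotal_quot => x y; apply: contrapT => /not_orP[xy yx].
  have [p [m [Mp ap]]] := mvmaximal_adjoin Mav Mmax M0 xy.
  have [q [n [Mq aq]]] := mvmaximal_adjoin Mav Mmax M0 yx.
  (* The two differences are disjoint, hence so are their multiples, and the
     two bounds on [a] give [a ≤ p ⊕ q]. *)
  apply/Ma/(Mle _ (p ⊕ q)); last exact: (MD _ _ Mp Mq).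
  have := mvmeet_nmul00 m n (mvmeet_sub0 x y); set s := mvnmul _ m.
  set t := mvnmul _ n => st; rewrite -[p ⊕ q]mv0add -st.
  apply: mvle_trans (mvmeet_addr _ _ _); apply: mvmeet_glb.
    by apply: mvle_trans ap _; rewrite mvaddC; apply: mvle_add => //; apply: mvle_addr.
  by apply: mvle_trans aq _; rewrite mvaddC; apply: mvle_add => //; apply: mvle_addl.
have Iprop : mvideal_set I <> [set: A] by move=> e; apply: Ma; rewrite [M]e.
by exists (MVSp Iprop Itot).
Qed.

End MVPrime.

(** * Absolute values and truncation in lattice-ordered groups *)

Section LGAbs.
Variable G : lgType.
Implicit Types x y z a b : G.

(** For [y >= 0], this characterizes [|x|] as [x ∨ - x]. *)
Lemma lgabs_leE x y : 0 <= y -> (lgabs x <= y) = (x <= y) && (- x <= y).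
Proof.
move=> y0; rewrite /lgabs lg_joinDr add0r lg_joinDl addr0 subrr.
by rewrite !lg_leUx y0 /= andbT andbC.
Qed.

Lemma lgabs_ge0 x : 0 <= lgabs x.
Proof. by apply: lg_addr_ge0; apply: lg_leUl. Qed.

Lemma lg_le_abs x : x <= lgabs x.
Proof. by have := lexx (lgabs x); rewrite lgabs_leE ?lgabs_ge0 // => /andP[]. Qed.

Lemma lg_leN_abs x : - x <= lgabs x.
Proof. by have := lexx (lgabs x); rewrite lgabs_leE ?lgabs_ge0 // => /andP[]. Qed.

Lemma lgabs0E x : lgabs x = 0 -> x = 0.
Proof.
move=> x0; apply: le_anti; rewrite -{1}x0 lg_le_abs /=.
by rewrite -lg_leN oppr0 -x0 lg_leN_abs.
Qed.

Lemma lgabs_pos x : 0 <= x -> lgabs x = x.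
Proof.
move=> x0; rewrite /lgabs lg_join_r // lg_join_l ?addr0 //.
by rewrite -lg_leN opprK oppr0.
Qed.

Lemma lg_meet_ge0 x y : 0 <= x -> 0 <= y -> 0 <= x ∧ y.
Proof. by move=> x0 y0; rewrite lg_lexI x0 y0. Qed.

Lemma lg_meet_mono x y a b : x <= a -> y <= b -> x ∧ y <= a ∧ b.
Proof.
move=> xa yb; rewrite lg_lexI (le_trans (lg_leIl _ _) xa).
by rewrite (le_trans (lg_leIr _ _) yb).
Qed.

(** Meet with [z] is subadditive on the positive cone. *)
Lemma lg_meet_subadd z a b : 0 <= z -> 0 <= a -> 0 <= b ->
  z ∧ (a + b) <= (z ∧ a) + (z ∧ b).
Proof.
move=> z0 a0 b0; rewrite lg_meetDr lg_lexI; apply/andP; split.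
  apply: le_trans (lg_leIl _ _) _; apply: lg_le_add0r.
  exact: lg_meet_ge0.
rewrite lg_meetDl; apply: lg_meet_mono => //; exact: lg_le_add0l.
Qed.

Lemma lg_meet_mulrn0 z a n : 0 <= z -> 0 <= a -> z ∧ a = 0 -> z ∧ (a *+ n) = 0.
Proof.
move=> z0 a0 za; elim: n => [|n IH]; first by rewrite mulr0n lg_meet_r.
apply: le_anti; rewrite lg_meet_ge0 ?lg_mulrn_ge0 // andbT mulrS.
apply: le_trans (lg_meet_subadd _ _ _) _ => //; first exact: lg_mulrn_ge0.
by rewrite za IH addr0.
Qed.

(** The positive parts of [x - y] and of [y - x] are disjoint. *)
Lemma lg_pos_disj x y : (0 ∨ (x - y)) ∧ (0 ∨ (y - x)) = 0.
Proof.
set p := 0 ∨ _; set q := 0 ∨ _.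
have -> : p = q + (x - y).
  by rewrite /p /q lg_joinDr add0r addrA subrK subrr lg_joinC.
rewrite -[X in _ ∧ X](addr0 q) -lg_meetDl -[_ ∧ _]opprK lg_meetN opprB oppr0.
by rewrite [_ ∨ 0]lg_joinC subrr.
Qed.

End LGAbs.

(** * Prime ideals of lattice-ordered groups with strong unit *)

Section LPrime.
Local Open Scope classical_set_scope.
Variable G : luType.
Implicit Types x y z : G.

Fact ltrunc_subproof x : 0 <= lgabs x ∧ lunit <= (lunit : G).
Proof. by rewrite lg_meet_ge0 ?lgabs_ge0 ?lunit_ge0 //= lg_leIr. Qed.

(** The truncation [|x| ∧ u], an element of the unit interval *)
Definition ltrunc x : Gamma G := MkGamma (ltrunc_subproof x).

Lemma ltrunc_id (a : Gamma G) : ltrunc (gval a) = a.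
Proof. by apply: gval_inj; rewrite /= lgabs_pos ?gval_ge0 // lg_meet_l ?gval_le1. Qed.

Lemma ltrunc_eq0 x : ltrunc x = mv0 -> x = 0.
Proof.
move=> /(congr1 (@gval G)); rewrite gval0 /= => xu.
have [n xn] := lunit_strong x; apply: lgabs0E; rewrite -(lg_meet_l xn).
by apply: lg_meet_mulrn0; rewrite ?lgabs_ge0 ?lunit_ge0.
Qed.

Lemma ltrunc_le x y z : lgabs x <= lgabs y + lgabs z ->
  mvle (ltrunc x) (mvadd (ltrunc y) (ltrunc z)).
Proof.
move=> xyz; rewrite gamma_leE gvalD /= lg_lexI lg_leIr /=.
rewrite lg_meetDr !lg_lexI; apply/andP; split; last first.
  apply: le_trans (lg_leIr _ _) _; apply: lg_le_add0r.
  exact: gval_ge0 (ltrunc z).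
rewrite lg_meetDl; apply: lg_meet_mono => //.
by rewrite lg_le_add0l ?lgabs_ge0.
Qed.

Section Extension.
Variable Q : mvSp (Gamma G).

(** The elements of [G] whose truncation lies in the prime ideal [Q]. This is
    the set of a prime [l]-ideal [lext], which by [ltrunc_id] meets the unit
    interval in [Q]. *)
Definition lext_set x : Prop := Q (ltrunc x).

Lemma lext_le x y z : lgabs x <= lgabs y + lgabs z ->
  lext_set y -> lext_set z -> lext_set x.
Proof. by move=> /ltrunc_le xyz Qy Qz; apply: mvideal_le xyz _; apply: mvidealD. Qed.

Lemma lext_bound x y z : x <= lgabs y + lgabs z -> - x <= lgabs y + lgabs z ->
  lext_set y -> lext_set z -> lext_set x.
Proof.
move=> h1 h2; apply: lext_le; rewrite lgabs_leE ?h1 ?h2 //.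
by rewrite lg_addr_ge0 ?lgabs_ge0.
Qed.

Fact lext_subgroup : is_subgroup lext_set.
Proof.
split=> [|x y].
  rewrite /lext_set (_ : 0 = gval (mv0 : Gamma G)) // ltrunc_id.
  exact: mvideal0.
apply: lext_bound; first by rewrite lg_leD ?lg_le_abs ?lg_leN_abs.
by rewrite opprB addrC lg_leD ?lg_le_abs ?lg_leN_abs.
Qed.

Fact lextU x y : lext_set x -> lext_set y -> lext_set (x ∨ y).
Proof.
apply: lext_bound; rewrite ?lg_joinN ?lg_leUx.
  by rewrite (le_trans (lg_le_abs _)) ?(le_trans (lg_le_abs y)) //
     ?lg_le_add0r ?lg_le_add0l ?lgabs_ge0.
apply: le_trans (lg_leIl _ _) _; apply: le_trans (lg_leN_abs _) _.
by rewrite lg_le_add0r ?lgabs_ge0.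
Qed.

Fact lext_convex x y z : lext_set x -> lext_set z ->
  x <= y -> y <= z -> lext_set y.
Proof.
move=> Px Pz xy yz; apply: lext_bound Px Pz.
  by apply: le_trans (lg_le_add0l _ (lgabs_ge0 _)); apply: le_trans (lg_le_abs _).
apply: le_trans (lg_le_add0r _ (lgabs_ge0 _)); apply: le_trans (lg_leN_abs _).
by rewrite lg_leN.
Qed.

Fact lextI x y : lext_set x -> lext_set y -> lext_set (x ∧ y).
Proof.
move=> Px Py; rewrite -[_ ∧ _]opprK lg_meetN.
by apply: (is_subgroupN lext_subgroup); apply: lextU; apply: (is_subgroupN lext_subgroup).
Qed.

Definition lext_ideal : lIdeal G := LIdeal lext_subgroup lextU lextI lext_convex.

Fact lext_proper : lideal_set lext_ideal <> [set: G].
Proof.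
move=> hP; apply: (@mvsp_proper _ Q); apply/funext => a; apply/propext; split=> // _.
by rewrite -(ltrunc_id a); suff : lext_ideal (gval a) by []; rewrite hP.
Qed.

(** The truncations of the two positive parts are disjoint, so that each is
    unchanged by subtracting the other in [Γ(G, u)]; one of the two truncated
    differences lies in [Q] because the quotient by [Q] is totally ordered. *)
Lemma lext_pos_or x y : lext_set (0 ∨ (x - y)) \/ lext_set (0 ∨ (y - x)).
Proof.
pose a := ltrunc (0 ∨ (x - y)); pose b := ltrunc (0 ∨ (y - x)).
have ab : gval a ∧ gval b = 0.
  apply: le_anti; rewrite lg_meet_ge0 ?gval_ge0 // andbT -(lg_pos_disj x y).
  by rewrite /= !lgabs_pos ?lg_leUl //; apply: lg_meet_mono; apply: lg_leIl.
have subE (c d : Gamma G) : gval c ∧ gval d = 0 -> mvmul c (mvneg d) = c.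
  move=> cd; apply: gval_inj; rewrite gvalB -(subrr (gval c)) -lg_joinDl.
  by rewrite -lg_meetN cd oppr0 addr0.
have /orP[/mvclass_le|/mvclass_le] := @mvsp_total _ Q (mvclass Q a) (mvclass Q b).
  by rewrite subE //; left.
by rewrite subE 1?lg_meetC //; right.
Qed.

Fact lext_total : total (@Order.le ring_display (lquot lext_ideal)).
Proof.
have le_pos x y : x <= y + (0 ∨ (x - y)) by rewrite addrC -lg_leBl lg_leUr.
move=> p q; have [x ->] := lclass_surj p; have [y ->] := lclass_surj q.
have [h|h] := lext_pos_or x y; apply/orP; [left|right]; apply/lclass_leE.
  by exists (0 ∨ (x - y)).
by exists (0 ∨ (y - x)).
Qed.

(** The prime [l]-ideal of [G] extending [Q] *)
Definition lext : lSp G := LSp lext_proper lext_total.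

End Extension.

(** [G] embeds into the product of its totally ordered quotients. *)
Lemma lcls_inj x y : (forall P : lSp G, lcls P x = lcls P y) -> x = y.
Proof.
move=> xy; apply/eqP; rewrite -subr_eq0; apply/eqP/ltrunc_eq0.
apply: contrapT => /mvprime_avoid[Q]; apply.
by have /lclass_eq := xy (lext Q).
Qed.

(** The unit interval generates [G]: a positive element [x <= (n + 1) u] is
    the sum of [x ∧ u] and of an element below [n u]. *)
Lemma gamma_generates (K : set G) :
  is_subgroup K -> (forall a : Gamma G, K (gval a)) -> forall x, K x.
Proof.
move=> hK Ka; have [K0 KB] := hK.
have Kpos n x : 0 <= x -> x <= lunit *+ n -> K x.
  elim: n x => [|n IH] x x0 xn.
    by rewrite (_ : x = 0) //; apply: le_anti; rewrite xn x0.
  rewrite -(subrK (x ∧ lunit) x); apply: is_subgroupD => //.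
    have -> : x - x ∧ lunit = 0 ∨ (x - lunit).
      by rewrite lg_meetN lg_joinDl subrr.
    apply: IH; rewrite ?lg_leUl // lg_leUx lg_mulrn_ge0 ?lunit_ge0 //=.
    by rewrite lg_leBl -mulrSr.
  by rewrite -(lgabs_pos x0); apply: (Ka (ltrunc x)).
move=> x; have [n xn] := lunit_strong x; rewrite -(lg_pos_neg x); apply: KB.
  by apply: (Kpos n); rewrite ?lg_leUl // (le_trans _ xn) // lg_le_add0r ?lg_leUl.
by apply: (Kpos n); rewrite ?lg_leUl // (le_trans _ xn) // lg_le_add0l ?lg_leUl.
Qed.

End LPrime.

(** * Morphisms out of Chang's groups *)

(** A monotone map defined on a chain preserves binary suprema and infima. *)
Section ChainHom.
Variables (C : luChainType) (H : lgType) (f : C -> H).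
Hypothesis f_mono : forall x y, x <= y -> f x <= f y.

Lemma chain_morphU : {morph f : x y / x ∨ y}.
Proof.
move=> x y; case/orP: (lu_le_total x y) => xy.
  by rewrite !lg_join_r // f_mono.
by rewrite !lg_join_l // f_mono.
Qed.

Lemma chain_morphI : {morph f : x y / x ∧ y}.
Proof.
move=> x y; case/orP: (lu_le_total x y) => xy.
  by rewrite !lg_meet_l // f_mono.
by rewrite !lg_meet_r // f_mono.
Qed.

End ChainHom.

Section ChHom.
Variables (C D : mvChainType) (f : mvHom C D).

Fact Ch_mapD : {morph Ch_map f : x y / x + y}.
Proof.
move=> x y; rewrite (chpair_repr y) Ch_mapE; apply: chc_inj => k.
by rewrite chc_map !chc_addr !chc_map mvhomD mvhomM.
Qed.

Fact Ch_map_mono x y : x <= y -> Ch_map f x <= Ch_map f y.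
Proof.
by move=> /chleP xy; apply/chleP => k; rewrite !chc_map; apply: mvhom_le.
Qed.

Fact Ch_map1 : Ch_map f lunit = lunit.
Proof. by rewrite [LHS]Ch_mapE mvhom1. Qed.

(** [Ch f] as a morphism of [l_u]-groups *)
Definition Ch_hom : luHom (Ch C) (Ch D) :=
  LuHom Ch_mapD (chain_morphU Ch_map_mono) (chain_morphI Ch_map_mono) Ch_map1.

End ChHom.

Section ChangHom.
Variable G : luChainType.

Fact changD : {morph @chang G : x y / x + y}.
Proof.
move=> x y; rewrite (chpair_repr x) (chpair_repr y).
move: (repr x) (repr y) => [m a] [n b] /=.
rewrite chpairD; case: eqP => ab; rewrite !changE.
  have le1 : lunit <= gval a + gval b.
    by rewrite -gval1 -ab gvalD lg_leIr.
  rewrite gvalM lg_join_r ?lg_subr_ge0 // !mulrzDr mulr1z -addrA.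
  by rewrite [lunit + _]addrC subrK addrACA.
have -> : gval (mvadd a b) = gval a + gval b.
  rewrite gvalD; case/orP: (lu_le_total lunit (gval a + gval b)) => le1.
    by case: ab; apply: gval_inj; rewrite gvalD gval1 lg_meet_l.
  by rewrite lg_meet_r.
by rewrite mulrzDr addrACA.
Qed.

Fact chang_mono (x y : Ch (Gamma G)) : x <= y -> chang x <= chang y.
Proof.
move=> /asboolP[[m a] [[n b] [-> -> ab]]].
rewrite -/(chpair m a) -/(chpair n b) !changE.
case/orP: ab => /= [mn|/andP[/eqP <-]]; last by rewrite gamma_leE lg_leD2l.
have [d ->] : exists d : nat, n = m + 1 + d%:Z.
  by exists (absz (n - m - 1)%R); lia.
rewrite !mulrzDr mulr1z -!addrA lg_leD2l.
apply: le_trans (gval_le1 a) _; apply: lg_le_add0r.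
apply: lg_addr_ge0 (gval_ge0 b).
by apply: lg_mulrn_ge0; apply: lunit_ge0.
Qed.

Fact chang1 : chang (lunit : Ch (Gamma G)) = lunit.
Proof. by rewrite changE gval1 mulr0z add0r. Qed.

(** Chang's map as a morphism of [l_u]-groups *)
Definition chang_hom : luHom (Ch (Gamma G)) G :=
  LuHom changD (chain_morphU chang_mono) (chain_morphI chang_mono) chang1.

End ChangHom.

(** * The functor induced on the generated groups *)

(** [A^*] is generated by [A°]: a subgroup that contains every [star_iota a]
    is everything. *)
Lemma star_ind (A : mvType) (K : set (star A)) :
  is_subgroup K -> (forall a, K (star_iota a)) -> forall s, K s.
Proof.
move=> [K0 KB] Ka s.
have /(_ _ (star_in s))[] : subset (@Astar A)
    (fun t => exists2 s', star_val s' = t & K s').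
  apply: smallest_sub => [|_ [a _ <-]]; last by exists (star_iota a).
  split; first by exists 0.
  by move=> _ _ [x <- Kx] [y <- Ky]; exists (x - y) => //; apply: KB.
by move=> s' /star_val_inj ->.
Qed.

Lemma star_hom_eq (A : mvType) (G : luType) (f g : luHom (star A) G) :
  (forall a, f (star_iota a) = g (star_iota a)) -> f = g.
Proof.
move=> fg; apply: luHom_eq; apply: star_ind fg.
split=> [|x y fx fy]; first by rewrite !luhom0.
by rewrite !luhomB fx fy.
Qed.

Section StarMap.
Variables (A B : mvType) (h : mvHom A B).
Implicit Types s t : prodCh A.

Lemma induced_iota a : induced h (iota_v a) = iota_v (h a).
Proof. by apply: prodCh_ext => P; rewrite /induced /iota_v Ch_mapE mvrestrE. Qed.

Lemma inducedD s t : induced h (s + t) = induced h s + induced h t.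
Proof. by apply: prodCh_ext => P; apply: (luhomD (Ch_hom (mvrestr h P))). Qed.

Lemma inducedU s t : induced h (s ∨ t) = induced h s ∨ induced h t.
Proof. by apply: prodCh_ext => P; apply: (luhomU (Ch_hom (mvrestr h P))). Qed.

Lemma inducedI s t : induced h (s ∧ t) = induced h s ∧ induced h t.
Proof. by apply: prodCh_ext => P; apply: (luhomI (Ch_hom (mvrestr h P))). Qed.

Lemma inducedB s t : induced h (s - t) = induced h s - induced h t.
Proof. by apply: prodCh_ext => P; apply: (luhomB (Ch_hom (mvrestr h P))). Qed.

Lemma induced0 : induced h 0 = 0.
Proof. by apply: prodCh_ext => P; apply: (luhom0 (Ch_hom (mvrestr h P))). Qed.

Fact star_map_subproof (s : star A) : induced h (star_val s) \in @in_Astar B.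
Proof.
apply/asboolP; have [As0 AsB] := @Astar_sub B; move: s; apply: star_ind.
  split=> [|x y hx hy]; first by rewrite induced0.
  by rewrite star_valD star_valN inducedB; apply: AsB.
by move=> a; rewrite induced_iota; apply: Acirc_sub_Astar.
Qed.

Definition star_map_fun (s : star A) : star B := MkStar (star_map_subproof s).

Fact star_mapD : {morph star_map_fun : x y / x + y}.
Proof. by move=> x y; apply: star_val_inj; apply: inducedD. Qed.
Fact star_mapU : {morph star_map_fun : x y / x ∨ y}.
Proof. by move=> x y; apply: star_val_inj; apply: inducedU. Qed.
Fact star_mapI : {morph star_map_fun : x y / x ∧ y}.
Proof. by move=> x y; apply: star_val_inj; apply: inducedI. Qed.

Lemma star_map_funE a : star_map_fun (star_iota a) = star_iota (h a).
Proof. by apply: star_val_inj; apply: induced_iota. Qed.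

Fact star_map1 : star_map_fun lunit = lunit.
Proof. by rewrite [LHS]star_map_funE mvhom1. Qed.

(** The morphism [h^* : A^* -> B^*] *)
Definition star_map : luHom (star A) (star B) :=
  LuHom star_mapD star_mapU star_mapI star_map1.

Lemma star_mapE a : star_map (star_iota a) = star_iota (h a).
Proof. exact: star_map_funE. Qed.

End StarMap.

Lemma star_map_functor :
  @is_functor MV_cat Gu_cat (fun A : mvType => star A : luType) star_map.
Proof.
split=> [A|A B C g f]; apply: star_hom_eq => a /=.
  by rewrite star_map_funE.
by rewrite !star_map_funE.
Qed.

(** * The isomorphism from an MV-algebra to the unit interval *)

Section IotaIso.
Variable A : mvType.

Lemma iota_v_inj : injective (@iota_v A).
Proof.
have sub0 (a b : A) : iota_v a = iota_v b -> mvmul a (mvneg b) = mv0.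
  move=> ab; apply: contrapT => /mvprime_avoid[P]; apply.
  have : mvcls P a = mvcls P b.
    have := congr1 (fun s => chc (s P) 0) ab.
    by rewrite !chc_iota !chco_eq.
  by move/mvclass_eq => -[].
have le (a b : A) : iota_v a = iota_v b -> mvle a b.
  by move=> ab; rewrite -(mvadd0 b) -mvres sub0.
by move=> a b ab; apply: mvle_anti; apply: le.
Qed.

(** [A°] is the unit interval of [A^*]: the coordinates of an element of the
    unit interval are [1] before [0] and [0] after [0], and its coordinate at
    [0] comes from an element of [A]. *)
Lemma Acirc_unit_interval (s : star A) : Acirc (star_val s) <-> 0 <= s <= lunit.
Proof.
split=> [[a _ /(star_val_inj (x1 := star_iota a)) <-]|/andP[s0 s1]].
  exact: iota_subproof.
have [N [h1 _ _]] := Astar_good (star_in s); have [a ha] := h1 0.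
exists a => //; apply: prodCh_ext => P; apply: chc_inj => k; rewrite chc_iota.
have /chleP le0 : 0 <= star_val s P by exact: (prod_leP _ _ s0 P).
have /chleP le1 : star_val s P <= iota_v mv1 P.
  exact: (prod_leP _ _ s1 P).
have [k0|k0|->] := ltgtP k 0.
- rewrite chco_lt //; apply/esym/mvle_eq1; apply: mvle_trans (le0 k).
  by rewrite [chc _ _]chc_pair chco_lt.
- rewrite chco_gt //; apply/esym/mvle_eq0; apply: mvle_trans (le1 k) _.
  by rewrite chc_iota chco_gt.
- by rewrite chco_eq.
Qed.

Lemma iota_hom_bij : bijective (iota_hom A).
Proof.
have surj (x : Gamma (star A)) : exists a, iota_hom A a = x.
  have /Acirc_unit_interval[a _ ax] := gvalP x.
  by exists a; apply/gval_inj/star_val_inj.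
have [g gK] := choice surj; exists g => // a; apply: iota_v_inj.
by have := gK (iota_hom A a) => /(congr1 (fun x => star_val (gval x))).
Qed.

End IotaIso.

Lemma mv_bij_iso (A B : mvType) (f : mvHom A B) : bijective f -> @is_iso MV_cat A B f.
Proof.
case=> g fK gK; have finj := can_inj fK.
have g0 : g mv0 = mv0 by rewrite -(mvhom0 f) fK.
have gN : {morph g : x / mvneg x} by move=> x; apply: finj; rewrite mvhomN !gK.
have gD : {morph g : x y / mvadd x y} by move=> x y; apply: finj; rewrite mvhomD !gK.
by exists (MVHom g0 gN gD); split; apply: mvHom_eq.
Qed.

Lemma lu_bij_iso (G H : luType) (f : luHom G H) : bijective f -> @is_iso Gu_cat G H f.
Proof.
case=> g fK gK; have finj := can_inj fK.
have gD : {morph g : x y / x + y} by move=> x y; apply: finj; rewrite luhomD !gK.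
have gU : {morph g : x y / x ∨ y} by move=> x y; apply: finj; rewrite luhomU !gK.
have gI : {morph g : x y / x ∧ y} by move=> x y; apply: finj; rewrite luhomI !gK.
have g1 : g lunit = lunit by rewrite -(luhom1 f) fK.
by exists (LuHom gD gU gI g1); split; apply: luHom_eq.
Qed.

(** * The isomorphism from the generated group to the original one *)

Section Upsilon.
Variable G : luType.
Implicit Types s t : star (Gamma G).

(** The component at [P] of the fiberwise map, as a morphism *)
Definition upsilon_at (P : lSp G) : luHom (Ch (mvfiber (ltrace P))) (lfiber P) :=
  lucomp (chang_hom (lfiber P)) (Ch_hom (gident P)).

Lemma upsilon_fibE (s : prodCh (Gamma G)) P :
  upsilon_fib s P = upsilon_at P (s (ltrace P)).
Proof. by []. Qed.

Lemma upsilon_fib_iota (a : Gamma G) P : upsilon_fib (iota_v a) P = lcls P (gval a).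
Proof. by rewrite /upsilon_fib /iota_v Ch_mapE gidentE changE mulr0z add0r. Qed.

(** The fiberwise map factors through the embedding of [G]: this holds on the
    generators [A°], and the elements with this property form a subgroup. *)
Lemma upsilon_factor s : exists x : G,
  forall P : lSp G, lcls P x = upsilon_fib (star_val s) P.
Proof.
move: s; apply: star_ind => [|a]; last by exists (gval a) => P; rewrite upsilon_fib_iota.
split=> [|s t [x hx] [y hy]].
  by exists 0 => P; rewrite upsilon_fibE star_val0 prodCh0E !luhom0.
exists (x - y) => P.
by rewrite upsilon_fibE star_valD star_valN prodChDE prodChNE !luhomB hx hy.
Qed.

(** The element of [G] whose classes are the values of the fiberwise map; it is
    unique by [lcls_inj]. *)
Definition upsilon_fun s : G := projT1 (cid (upsilon_factor s)).

Lemma upsilon_funE s P : lcls P (upsilon_fun s) = upsilon_fib (star_val s) P.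
Proof. by rewrite /upsilon_fun; case: cid. Qed.

Fact upsilonD : {morph upsilon_fun : s t / s + t}.
Proof.
move=> s t; apply: lcls_inj => P.
by rewrite luhomD !upsilon_funE !upsilon_fibE star_valD prodChDE luhomD.
Qed.
Fact upsilonU : {morph upsilon_fun : s t / s ∨ t}.
Proof.
move=> s t; apply: lcls_inj => P.
by rewrite luhomU !upsilon_funE !upsilon_fibE star_valU prodChUE luhomU.
Qed.
Fact upsilonI : {morph upsilon_fun : s t / s ∧ t}.
Proof.
move=> s t; apply: lcls_inj => P.
by rewrite luhomI !upsilon_funE !upsilon_fibE star_valI prodChIE luhomI.
Qed.

Lemma upsilon_fun_iota (a : Gamma G) : upsilon_fun (star_iota a) = gval a.
Proof. by apply: lcls_inj => P; rewrite upsilon_funE upsilon_fib_iota. Qed.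

Fact upsilon1 : upsilon_fun lunit = lunit.
Proof. by rewrite [LHS]upsilon_fun_iota gval1. Qed.

(** The morphism [υ : Γ(G, u)^* -> (G, u)] *)
Definition upsilon : luHom (star (Gamma G)) G :=
  LuHom upsilonD upsilonU upsilonI upsilon1.

(** If [s] is in the kernel, then so is its truncation. The truncation is some
    [star_iota a] by [Acirc_unit_interval], and its image is [a], so [a = 0]. *)
Lemma upsilon_inj : injective upsilon.
Proof.
have ker0 s : upsilon s = 0 -> s = 0.
  move=> s0; apply: ltrunc_eq0; apply: gval_inj.
  have /Acirc_unit_interval[a _ ha] := gvalP (ltrunc s).
  have {}ha : gval (ltrunc s) = star_iota a by apply: star_val_inj.
  have a0 : gval a = 0.
    rewrite -(upsilon_fun_iota a) -ha /= upsilonI upsilonD !upsilonU.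
    rewrite -[upsilon_fun (- s)]/(upsilon (- s)) -[upsilon_fun 0]/(upsilon 0).
    rewrite -[upsilon_fun s]/(upsilon s) luhomN luhom0 s0 oppr0.
    by rewrite lg_join_l // addr0 upsilon1 lg_meet_l ?lunit_ge0.
  have -> : gval (ltrunc s) = star_iota mv0 by rewrite ha; congr star_iota; apply: gval_inj.
  by rewrite -(mvhom0 (iota_hom (Gamma G))).
move=> s t st; apply/eqP; rewrite -subr_eq0; apply/eqP/ker0.
by rewrite luhomB st subrr.
Qed.

Lemma upsilon_bij : bijective upsilon.
Proof.
have surj x : exists s, upsilon s = x.
  move: x; apply: gamma_generates => [|a].
    split=> [|_ _ [s <-] [t <-]]; first by exists 0; rewrite luhom0.
    by exists (s - t); rewrite luhomB.
  by exists (star_iota a); apply: upsilon_fun_iota.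
have [g gK] := choice surj; exists g => // s; exact: upsilon_inj.
Qed.

End Upsilon.

Theorem theorem3p4 :
  exists star_map : forall A B : mvType, mvHom A B -> luHom (star A) (star B),
    (forall (A B : mvType) (h : mvHom A B),
      [/\ forall s : star A,
            star_val (star_map A B h s) = induced h (star_val s),
          (forall s : star A, Acirc (star_val s) <-> 0 <= s <= lunit) /\
          (forall t : star B, Acirc (star_val t) <-> 0 <= t <= lunit),
          forall s : star A,
            Acirc (star_val s) -> Acirc (star_val (star_map A B h s)),
          forall x : Gamma (star A),
            gval (Gamma_map (star_map A B h) x) = star_map A B h (gval x)
        & mvcomp (Gamma_map (star_map A B h)) (iota_hom A)
            = mvcomp (iota_hom B) h]) /\
    exists starP : @is_functor MV_cat Gu_cat (fun A : mvType => star A : luType) star_map,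
      let starF : functor MV_cat Gu_cat := Functor starP in
      [/\ is_natural (F := idF MV_cat) (G := compF Gamma_functor starF) iota_hom,
          forall A : mvType, @is_iso MV_cat A (Gamma (star A)) (iota_hom A)
        & exists upsilon : forall G : luType, luHom (star (Gamma G)) G,
            [/\ forall (G : luType) (s : star (Gamma G)) (P : lSp G),
                  lcls P (upsilon G s) = upsilon_fib (star_val s) P,
                is_natural (F := compF starF Gamma_functor) (G := idF Gu_cat) upsilon
              & forall G : luType, @is_iso Gu_cat (star (Gamma G)) G (upsilon G)]].
Proof.
have square (A B : mvType) (h : mvHom A B) :
    mvcomp (Gamma_map (star_map h)) (iota_hom A) = mvcomp (iota_hom B) h.
  by apply: mvHom_eq => a; apply: gval_inj; apply: star_mapE.
exists star_map; split=> [A B h|].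
  split=> //; first by split; apply: Acirc_unit_interval.
  by move=> s [a _ sa]; exists (h a) => //; rewrite -induced_iota sa.
exists star_map_functor; split=> [A B h|A|].
- by rewrite [RHS]square.
- exact/mv_bij_iso/iota_hom_bij.
exists upsilon; split=> [G s P|G H f|G].
- exact: upsilon_funE.
- by apply: star_hom_eq => a /=; rewrite star_map_funE !upsilon_fun_iota.
- exact/lu_bij_iso/upsilon_bij.
Qed.
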